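(* Let $\{Q_n\}_{n\ge1}$ be a sequence of symmetric, zero-diagonal $v$-tensors such that $\|W_{Q_n}-W_\infty\|_{\square^*}\to0$ as $n\to\infty$, for some $W_\infty\in\mathcal W_v$, and let $\boldsymbol h\in\mathbb R^c$. Then the following hold. (i) Let $\mathbf X=(X_1,\ldots,X_n)$ with $X_i$ i.i.d. from $\mu$, where $\mu_r=e^{h_r}/\sum_{s=1}^c e^{h_s}$ for $r\in[c]$. Then for any $\boldsymbol\alpha\in\mathbb R^c$, $\boldsymbol\alpha^\top\boldsymbol N_n(Q_n,\mathbf X)$ satisfies a large deviation principle with speed $n$ and the good rate function $$I_{W_\infty,\boldsymbol\alpha}(t):=\inf_{\boldsymbol f\in\mathcal F_c:\ \boldsymbol\alpha^\top\boldsymbol G_{W_\infty}(\boldsymbol f)=t}\left\{\int_0^1\sum_{r=1}^c f_r(u)\log f_r(u)\,du-\sum_{r=1}^c h_r\int_0^1 f_r(u)\,du\right\}+\log\sum_{s=1}^c e^{h_s}.$$ (ii) For any $\boldsymbol\alpha\in\mathbb R^c$, $$\lim_{n\to\infty}\mathcal Z_{Q_n}(\boldsymbol\alpha,\boldsymbol h)=\sup_{\boldsymbol f\in\mathcal F_c}\left\{\boldsymbol\alpha^\top\boldsymbol G_{W_\infty}(\boldsymbol f)+\sum_{r=1}^c h_r\int_0^1 f_r(u)\,du-\int_0^1\sum_{r=1}^c f_r(u)\log f_r(u)\,du\right\}-\log c,$$ and the supremum is attained. (iii) Let $\boldsymbol\alpha\in\mathbb R^c$, let $\mathcal A\subseteq\mathcal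 F_c$ be the set of maximizers of the supremum in (ii), and let $$\mathcal S:=\left\{\Big(\int_0^1 f_1(u)\,du,\ldots,\int_0^1 f_c(u)\,du\Big):\ \boldsymbol f=(f_1,\ldots,f_c)\in\mathcal A\right\}.$$ Then for every $\varepsilon>0$, $$\mathcal R_{Q_n,\boldsymbol\alpha,\boldsymbol h}\big(\operatorname{dist}(\boldsymbol m_n(\mathbf X),\mathcal S)>\varepsilon\big)\xrightarrow{n\to\infty}0.$$ In particular, if $\mathcal A=\{\boldsymbol f^*\}$, then under $\mathcal R_{Q_n,\boldsymbol\alpha,\boldsymbol h}$, $$\boldsymbol m_n(\mathbf X)\to\Big(\int_0^1 f_1^*(u)\,du,\ldots,\int_0^1 f_c^*(u)\,du\Big)\quad\text{in probability as } n\to\infty.$$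
   Context: Integers $c,v\ge2$ are fixed and $[m]:=\{1,\ldots,m\}$. A $v$-tensor $Q_n:[n]^v\to\mathbb R$ is symmetric if it is invariant under permutations of its arguments, and zero-diagonal if $Q_n(i_1,\ldots,i_v)=0$ whenever $i_1,\ldots,i_v$ are not all distinct. $\mathcal W_v$ is the space of symmetric real-valued functions in $L^1([0,1]^v)$; $W_{Q_n}\in\mathcal W_v$ is defined by $W_{Q_n}(x_1,\ldots,x_v):=Q_n(i_1,\ldots,i_v)$ if $\max\{\lceil nx_r\rceil,1\}=i_r$ for all $r\in[v]$. For $W\in\mathcal W_v$, $\|W\|_{\square^*}:=\sup_{S\subseteq[0,1]}\left|\int_{S^v}W\prod_i dx_i\right|$ (measurable $S$). For $\mathbf X\in[c]^n$, $\boldsymbol N_n(Q_n,\mathbf X):=(N_n^{(1)}(Q_n,\mathbf X),\ldots,N_n^{(c)}(Q_n,\mathbf X))^\top$ with $$N_n^{(r)}(Q_n,\mathbf X):=\frac1{n^v}\sum_{i_1,\ldots,i_v=1}^n\mathbf 1_{\{X_{i_1}=\cdots=X_{i_v}=r\}}Q_n(i_1,\ldots,i_v).$$ With $\mathscr U[c]$ the uniform distribution on $[c]$, the Gibbs (probability) measure on $[c]^n$ is $$\frac{d\mathcal R_{Q_n,\boldsymbol\alpha,\boldsymbol h}}{d(\mathscr U[c])^{\otimes n}}(\mathbf X):=\exp\Big(n\boldsymbol\alpha^\top\boldsymbol N_n(Q_n,\mathbf X)+\sum_{i=1}^n\sum_{a=1}^c h_a\mathbf 1_{\{X_i=a\}}-n\mathcal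 Z_{Q_n}(\boldsymbol\alpha,\boldsymbol h)\Big),$$ $$\mathcal Z_{Q_n}(\boldsymbol\alpha,\boldsymbol h):=\frac1n\log\mathbb E_{(\mathscr U[c])^{\otimes n}}\exp\Big(n\boldsymbol\alpha^\top\boldsymbol N_n(Q_n,\mathbf X)+\sum_{i=1}^n\sum_{a=1}^c h_a\mathbf 1_{\{X_i=a\}}\Big).$$ The empirical color proportion vector is $\boldsymbol m_n(\boldsymbol x):=\big(\frac1n\sum_{i=1}^n\mathbf 1_{\{x_i=1\}},\ldots,\frac1n\sum_{i=1}^n\mathbf 1_{\{x_i=c\}}\big)$, and $\operatorname{dist}(\boldsymbol x,\mathcal S):=\inf_{\boldsymbol y\in\mathcal S}\|\boldsymbol x-\boldsymbol y\|$ for a fixed norm on $\mathbb R^c$. $\mathcal F_c$ is the set of measurable $\boldsymbol f=(f_1,\ldots,f_c):[0,1]\to[0,1]^c$ with $\sum_{r=1}^c f_r(x)=1$ for all $x$ (modulo a.e. equality), and $\boldsymbol G_W(\boldsymbol f):=(G_{W,\mathbf 1_1}(\boldsymbol f),\ldots,G_{W,\mathbf 1_c}(\boldsymbol f))$ with $$G_{W,\mathbf 1_r}(\boldsymbol f):=\int_{[0,1]^v}W(x_1,\ldots,x_v)\prod_{a=1}^v f_r(x_a)\,dx_1\cdots dx_v.$$ Conventions: $0\log0=0$, $\inf\emptyset=+\infty$. *)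

(* Defs.v *)
From HB Require Import structures.
From mathcomp Require Import all_boot all_order all_algebra.
From mathcomp Require Import perm.
From mathcomp Require Import all_classical all_reals all_analysis.

Set Implicit Arguments.
Unset Strict Implicit.
Unset Printing Implicit Defensive.

Import Order.TTheory GRing.Theory Num.Theory.
Import numFieldNormedType.Exports.

Local Open Scope classical_set_scope.
Local Open Scope ring_scope.

Section power_measure.
Context d (T : measurableType d) (R : realType).
Variable mu : {sigma_finite_measure set T -> \bar R}.

Definition cons_pair n (p : T * n.-tuple T) : n.+1.-tuple T :=
  [the n.+1.-tuple T of p.1 :: p.2].

Lemma measurable_cons_pair n : measurable_fun setT (@cons_pair n).
Proof. by apply: measurable_cons. Qed.

Definition power_step n (nu : {sigma_finite_measure set (n.-tuple T) -> \bar R})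
  : set (n.+1.-tuple T) -> \bar R := pushforward (mu \x nu)%E (@cons_pair n).

Section instances.
Variables (n : nat) (nu : {sigma_finite_measure set (n.-tuple T) -> \bar R}).

Let power_step0 : power_step nu set0 = 0%E.
Proof. by rewrite /power_step /pushforward preimage_set0 measure0. Qed.

Let power_step_ge0 A : (0 <= power_step nu A)%E.
Proof. by rewrite /power_step /pushforward; apply: measure_ge0. Qed.

Let power_step_sigma_additive : semi_sigma_additive (power_step nu).
Proof.
move=> F mF tF mUF; rewrite /power_step /pushforward preimage_bigcup.
have mC := @measurable_cons_pair n.
apply: measure_semi_sigma_additive.
- by move=> k; rewrite -[X in measurable X]setTI; exact: mC.
- apply/trivIsetP => /= i j _ _ ij; rewrite -preimage_setI.
  by move/trivIsetP : tF => /(_ _ _ _ _ ij) ->//; rewrite preimage_set0.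
- by rewrite -preimage_bigcup -[X in measurable X]setTI; exact: mC.
Qed.

HB.instance Definition _ := isMeasure.Build _ _ _ (power_step nu)
  power_step0 power_step_ge0 power_step_sigma_additive.

Let power_step_sigma_finite : sigma_finite setT (power_step nu).
Proof.
have /sigma_finiteP[F [TF ndF Foo]] := sigma_finiteT mu.
have /sigma_finiteP[G [TG ndG Goo]] := sigma_finiteT nu.
pose g (t : n.+1.-tuple T) : T * n.-tuple T := (thead t, [tuple of behead t]).
have gK p : g (cons_pair p) = p.
  by case: p => x t; congr pair; apply: val_inj.
have mg : measurable_fun setT g.
  apply/measurable_fun_pairP; split; first exact: measurable_tnth.
  exact: measurable_behead.
exists (fun k => g @^-1` (F k `*` G k)).
  apply/esym; rewrite -subTset => t _.
  have [j _ Fj] : (\bigcup_i F i) (g t).1 by rewrite -TF.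
  have [k _ Gk] : (\bigcup_i G i) (g t).2 by rewrite -TG.
  exists (maxn j k) => //; split.
    by move: Fj; exact/subsetPset/ndF/leq_maxl.
  by move: Gk; exact/subsetPset/ndG/leq_maxr.
move=> k; have [mF Fk] := Foo k; have [mG Gk] := Goo k; split.
  by rewrite -[X in measurable X]setTI; apply: mg => //; exact: measurableX.
rewrite /power_step /pushforward (_ : _ @^-1` _ = F k `*` G k); last first.
  by apply/funext => p; rewrite -{2}(gK p).
by rewrite product_measure1E// lte_mul_pinfty// ge0_fin_numE.
Qed.

HB.instance Definition _ := Measure_isSigmaFinite.Build _ _ _ (power_step nu)
  power_step_sigma_finite.

End instances.

Fixpoint power_measure n : {sigma_finite_measure set (n.-tuple T) -> \bar R} :=
  match n with
  | 0 => [the {sigma_finite_measure set (0.-tuple T) -> \bar R} of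
            dirac [tuple]]
  | m.+1 => [the {sigma_finite_measure set (m.+1.-tuple T) -> \bar R} of
            power_step (power_measure m)]
  end.

Lemma power_measure_box n (A : 'I_n -> set T) :
  (forall i, measurable (A i)) ->
  (power_measure n [set x | forall i, A i (tnth x i)] =
     \prod_(i < n) mu (A i))%E.
Proof.
elim: n A => [|n IHn] A mA /=.
  rewrite big_ord0 /dirac indicE mem_set//; by case.
rewrite /power_step /pushforward.
rewrite (_ : _ @^-1` _ = A ord0 `*`
    [set x | forall i, A (lift ord0 i) (tnth x i)]); last first.
  apply/seteqP; split => -[x t] /=.
    by move=> Axt; split=> [|i]; [have := Axt ord0|have := Axt (lift ord0 i)];
      rewrite ?tnthS ?tnth0.
  move=> [Ax At] i; case: (unliftP ord0 i) => [j|] ->; last by rewrite tnth0.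
  by rewrite tnthS; exact: At.
rewrite product_measure1E//; first by rewrite big_ord_recl -IHn.
rewrite (_ : [set _ | _] = \bigcap_(i in [set: 'I_n])
    ((fun x => tnth x i) @^-1` A (lift ord0 i))); last first.
  by apply/seteqP; split => x /= H i => [_|]; apply: H.
apply: fin_bigcap_measurable => [|i _]; first exact: finite_finset.
by rewrite -[X in measurable X]setTI; exact: measurable_tnth.
Qed.

End power_measure.

Section large_deviations.
Context (R : realType) (T : topologicalType).

Definition good_rate_function (I : T -> \bar R) : Prop :=
  [/\ forall t, (0 <= I t)%E,
      lower_semicontinuous I &
      forall a : R, compact [set t | (I t <= a%:E)%E] ].

(* L n is the law of the n-th random element. *)
Definition satisfies_LDP (L : nat -> set T -> \bar R) (speed : nat -> R)
    (I : T -> \bar R) : Prop :=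
  (forall F : set T, closed F ->
     (limn_esup (fun n => ((speed n)^-1)%:E * lne (L n F))
        <= - ereal_inf (I @` F))%E) /\
  (forall G : set T, open G ->
     (- ereal_inf (I @` G)
        <= limn_einf (fun n => ((speed n)^-1)%:E * lne (L n G)))%E).

End large_deviations.

Section vectors.
Context (R : realType) (c : nat).
Implicit Types (x y : 'rV[R]_c) (nrm : 'rV[R]_c -> R).

Definition dot x y : R := \sum_(r < c) x ord0 r * y ord0 r.

Definition is_norm nrm : Prop :=
  [/\ forall x, nrm x = 0 -> x = 0,
      forall (a : R) x, nrm (a *: x) = `|a| * nrm x &
      forall x y, nrm (x + y) <= nrm x + nrm y].

(* Extended real, so that the distance to the empty set is +oo. *)
Definition dist nrm x (S : set 'rV[R]_c) : \bar R :=
  ereal_inf [set (nrm (x - y))%:E | y in S].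

End vectors.

Section tensors.
Context (R : realType) (v : nat).

(* Indices are shifted by one: [n] is 'I_n = {0, ..., n-1}. *)
Definition tensor (n : nat) := v.-tuple 'I_n -> R.

Definition permute (T : Type) (s : 'S_v) (x : v.-tuple T) : v.-tuple T :=
  [tuple tnth x (s a) | a < v].

Definition symmetric_tensor n (Q : tensor n) : Prop :=
  forall (s : 'S_v) i, Q (permute s i) = Q i.

Definition zero_diagonal n (Q : tensor n) : Prop :=
  forall i : v.-tuple 'I_n, ~~ uniq i -> Q i = 0.

Definition lebesgue_power :
    {sigma_finite_measure set (v.-tuple (measurableTypeR R)) -> \bar R} :=
  power_measure (@lebesgue_measure R) v.

Definition cartesian_power (S : set R) : set (v.-tuple (measurableTypeR R)) :=
  [set x | forall a, S (tnth x a)].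

Definition cube : set (v.-tuple (measurableTypeR R)) := cartesian_power `[0, 1].

(* The symmetric elements of L^1([0,1]^v); as these are classes modulo almost
   everywhere equality, so is the symmetry.  Values off the cube are
   irrelevant. *)
Definition kernel_space (W : v.-tuple (measurableTypeR R) -> R) : Prop :=
  lebesgue_power.-integrable cube (EFin \o W) /\
  forall s : 'S_v,
    \forall x \ae lebesgue_power, cube x -> W (permute s x) = W x.

(* The successor in (tnth i a).+1 undoes the shift of indices; the value is 0
   where no index fits (n = 0, or a coordinate > 1). *)
Definition step_kernel n (Q : tensor n) (x : v.-tuple (measurableTypeR R)) : R :=
  if [pick i : v.-tuple 'I_n |
        [forall a, Num.max (Num.ceil (n%:R * tnth x a)) 1
                     == (tnth i a).+1%:Z] ] is Some i
  then Q i else 0.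

Definition cut_norm (W : v.-tuple (measurableTypeR R) -> R) : \bar R :=
  ereal_sup [set `| \int[lebesgue_power]_(x in cartesian_power S) (W x)%:E |%E
            | S in [set S : set R | measurable S /\ S `<=` `[0, 1] ] ].

Variable c : nat.

Definition color_counts n (Q : tensor n) (X : n.-tuple 'I_c) : 'rV[R]_c :=
  \row_r ((n%:R ^+ v)^-1 *
    \sum_(i : v.-tuple 'I_n | [forall a, tnth X (tnth i a) == r]) Q i).

Definition kernel_functional (W : v.-tuple (measurableTypeR R) -> R) (f : R -> 'rV[R]_c) :
    'rV[R]_c :=
  \row_r (\int[lebesgue_power]_(x in cube)
            (W x * \prod_(a < v) f (tnth x a) ord0 r)).

End tensors.

Section color_functions.
Context (R : realType) (c : nat).
Implicit Types f : R -> 'rV[R]_c.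

(* Representatives of the elements of F_c. *)
Definition color_fun f : Prop :=
  [/\ forall r, measurable_fun (`[0, 1] : set R) (fun x => f x ord0 r),
      forall x, x \in `[0, 1] -> forall r, 0 <= f x ord0 r <= 1 &
      forall x, x \in `[0, 1] -> \sum_(r < c) f x ord0 r = 1].

Definition mean f : 'rV[R]_c :=
  \row_r (\int[lebesgue_measure]_(u in `[0, 1]) f u ord0 r).

(* ln 0 = 0, so 0 log 0 = 0. *)
Definition entropy f : R :=
  \int[lebesgue_measure]_(u in `[0, 1])
    \sum_(r < c) f u ord0 r * ln (f u ord0 r).

End color_functions.

Section colorings.
Context (R : realType) (c : nat).

Section product_law.
Variables (p : 'rV[R]_c) (n : nat).

Definition iid_expect (F : n.-tuple 'I_c -> R) : R :=
  \sum_(x : n.-tuple 'I_c) (\prod_(i < n) p ord0 (tnth x i)) * F x.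

Definition iid_prob (E : set (n.-tuple 'I_c)) : R := iid_expect (\1_E).

End product_law.

Definition softmax (h : 'rV[R]_c) : 'rV[R]_c :=
  \row_r (expR (h ord0 r) / \sum_(s < c) expR (h ord0 s)).

Definition uniform_law : 'rV[R]_c := const_mx c%:R^-1.

Definition proportions n (x : n.-tuple 'I_c) : 'rV[R]_c :=
  \row_r (n%:R^-1 * \sum_(i < n) (tnth x i == r)%:R).

Section gibbs.
Context (v n : nat).
Variables (Q : tensor R v n) (alpha h : 'rV[R]_c).

Definition hamiltonian (X : n.-tuple 'I_c) : R :=
  n%:R * dot alpha (color_counts Q X) +
  \sum_(i < n) \sum_(a < c) h ord0 a * (tnth X i == a)%:R.

Definition log_partition : R :=
  n%:R^-1 * ln (iid_expect uniform_law (fun X => expR (hamiltonian X))).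

Definition gibbs (E : set (n.-tuple 'I_c)) : R :=
  iid_expect uniform_law
    (fun X => expR (hamiltonian X - n%:R * log_partition) * \1_E X).

End gibbs.

Section variational.
Context (v : nat).
Variables (W : v.-tuple (measurableTypeR R) -> R) (alpha h : 'rV[R]_c).

Definition rate (t : R) : \bar R :=
  (ereal_inf [set (entropy f - dot h (mean f))%:E | f in
               [set f | color_fun f /\ dot alpha (kernel_functional W f) = t] ]
   + (ln (\sum_(s < c) expR (h ord0 s)))%:E)%E.

Definition free_energy (f : R -> 'rV[R]_c) : R :=
  dot alpha (kernel_functional W f) + dot h (mean f) - entropy f.

Definition sup_free_energy : \bar R :=
  ereal_sup [set (free_energy f)%:E | f in @color_fun R c].

Definition maximizers : set (R -> 'rV[R]_c) :=
  [set f | color_fun f /\ (free_energy f)%:E = sup_free_energy].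

End variational.

End colorings.

(* Main.v *)
(* For a coloring X let f_X be the step function on [0,1] equal to the X_i-th unit
   vector on the i-th cell of length 1/n.  The colors of f_X are indicators, so the
   color counts of (Q_n, X) and G_W(f_X) differ by an integral of W_{Q_n} - W over a
   set S^v, hence by at most the cut norm, uniformly in X.  This reduces everything to
   the random element f_X of F_c in the weak topology, for which
   - G_W is continuous, W being approximable in L^1 by combinations of boxes;
   - F_c is compact: along an ultrafilter the integrals over measurable sets converge
     to a measure dominated by Lebesgue measure, and its density is the weak limit;
   - the relative entropy I is the supremum of the linear functionals
     f |-> int sum_r lam_r f_r over the tiltings sum_r p_r exp (lam_r) = 1, and
     E exp (n int sum_r lam_r (f_X)_r) <= 1 by Jensen's inequality on each cell;
   - tilting the color of vertex i by the average of f over the i-th cell costs at most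
     n I(f) in relative entropy, again by Jensen, and makes f_X weakly close to f.
   The third point and compactness give the upper bounds, the fourth one the lower
   bounds. *)

From HB Require Import structures.
Require Import Defs.
From mathcomp Require Import all_boot all_order all_algebra.
From mathcomp Require Import finmap.
From mathcomp Require Import all_classical all_reals all_analysis.
From mathcomp Require Import measurable_realfun.
From mathcomp Require Import ring lra.

Set Implicit Arguments.
Unset Strict Implicit.
Unset Printing Implicit Defensive.

Import Order.TTheory GRing.Theory Num.Theory.
Import numFieldNormedType.Exports HBSimple.

Local Open Scope classical_set_scope.
Local Open Scope ring_scope.

(** * Product laws on colorings *)

Section product_laws.
Context (R : realType) (c n : nat).
Implicit Types (q : 'I_n -> 'I_c -> R).

(** No topology is put on the color functions: weak convergence is a predicate on filters, and a
    weak neighborhood of [f] is a set that belongs to every filter of color functions converging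
    weakly to [f]. Finite covers are thereby avoided. Each use of compactness has the same shape: a
    putative counterexample yields a proper filter, an ultrafilter finer than it has a weak limit,
    and this limit contradicts the local hypothesis. In particular strict inequalities that hold for
    each [f] separately produce one exponent strictly below the bound. The reference law is
    [softmax h] and not the uniform one. The field [h] then leaves the Hamiltonian, and
    [entropy f - dot h (mean f)] is a relative entropy up to the constant [ln (\sum_s expR (h s))].
    One upper estimate of the moments of [exp (n Psi)] over an event serves all three claims: with
    [Psi = 0] it bounds the probabilities of the large deviation principle, with the energy it
    bounds the partition function and, for an event of bad colorings, the numerator of a Gibbs
    probability. *)

Definition product_weight q (x : n.-tuple 'I_c) : R := \prod_(i < n) q i (tnth x i).

Lemma sum_product_weight q :
  \sum_x product_weight q x = \prod_(i < n) \sum_(r < c) q i r.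
Proof.
rewrite bigA_distr_bigA /= (reindex (fun x : n.-tuple 'I_c => [ffun i => tnth x i])) /=.
  by apply: eq_bigr => x _; apply: eq_bigr => i _; rewrite ffunE.
exists (fun f : {ffun 'I_n -> 'I_c} => [tuple f i | i < n]) => [x _|f _].
  by apply: eq_from_tnth => i; rewrite tnth_mktuple ffunE.
by apply/ffunP => i; rewrite ffunE tnth_mktuple.
Qed.

Variable q : 'I_n -> 'I_c -> R.
Hypothesis q_ge0 : forall i r, 0 <= q i r.
Hypothesis q_sum : forall i, \sum_(r < c) q i r = 1.

Lemma product_weight_sum1 : \sum_x product_weight q x = 1.
Proof. by rewrite sum_product_weight big1. Qed.

(** The pointwise product of [q] and [G] is again a product weight. Marginals, independence and
    exponential moments are all obtained by a choice of [G]. *)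
Lemma product_weight_prod (G : 'I_n -> 'I_c -> R) :
  \sum_x product_weight q x * \prod_(i < n) G i (tnth x i) =
  \prod_(i < n) \sum_(r < c) q i r * G i r.
Proof.
rewrite -sum_product_weight; apply: eq_bigr => x _.
by rewrite /product_weight -big_split.
Qed.

Lemma product_weight_marginal i (g : 'I_c -> R) :
  \sum_x product_weight q x * g (tnth x i) = \sum_(r < c) q i r * g r.
Proof.
have := product_weight_prod (fun k r => if k == i then g r else 1).
rewrite [RHS](bigD1 i)//= eqxx [X in _ = _ * X]big1 => [|k /negPf ki]; last first.
  by rewrite ki; under eq_bigr do rewrite mulr1.
rewrite mulr1 => <-; apply: eq_bigr => x _; rewrite (bigD1 i)//= eqxx big1 ?mulr1//.
by move=> k /negPf ->.
Qed.

Lemma product_weight_indep i j (g g' : 'I_c -> R) : i != j ->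
  \sum_x product_weight q x * (g (tnth x i) * g' (tnth x j)) =
  (\sum_(r < c) q i r * g r) * (\sum_(r < c) q j r * g' r).
Proof.
move=> ij; have ji : (j == i) = false by rewrite eq_sym (negPf ij).
have := product_weight_prod
  (fun k r => if k == i then g r else if k == j then g' r else 1).
rewrite [RHS](bigD1 i)//= eqxx (bigD1 j) ?ji//= ?ji ?eqxx.
rewrite [X in _ = _ * (_ * X)]big1 => [|k /andP[/negPf ki /negPf kj]]; last first.
  by rewrite ki kj; under eq_bigr do rewrite mulr1.
rewrite mulr1 => <-; apply: eq_bigr => x _; congr (_ * _).
rewrite (bigD1 i)//= eqxx (bigD1 j) ?ji//= ?ji ?eqxx big1 ?mulr1//.
by move=> k /andP[/negPf -> /negPf ->].
Qed.

(** The centered indicators are independent, so only the diagonal terms remain, and each indicator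
    minus its mean is at most 1 in absolute value. *)
Lemma product_weight_variance (a : 'I_n -> R) (r : 'I_c) :
  \sum_x product_weight q x *
     (\sum_(i < n) a i * ((tnth x i == r)%:R - q i r)) ^+ 2
  <= \sum_(i < n) a i ^+ 2.
Proof.
pose Z i (s : 'I_c) := a i * ((s == r)%:R - q i r).
have EZ i : \sum_(s < c) q i s * Z i s = 0.
  under eq_bigr do rewrite /Z mulrCA mulrBr.
  rewrite -mulr_sumr sumrB -mulr_suml q_sum mul1r.
  rewrite (bigD1 r)//= eqxx mulr1 big1 ?addr0 ?subrr ?mulr0//.
  by move=> s /negPf ->; rewrite mulr0.
have -> : \sum_x product_weight q x *
     (\sum_(i < n) a i * ((tnth x i == r)%:R - q i r)) ^+ 2 =
   \sum_(i < n) \sum_(j < n)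
     \sum_x product_weight q x * (Z i (tnth x i) * Z j (tnth x j)).
  under [RHS]eq_bigr do rewrite exchange_big.
  rewrite [RHS]exchange_big; apply: eq_bigr => x _.
  under [RHS]eq_bigr do rewrite -mulr_sumr -mulr_sumr.
  by rewrite -mulr_sumr -mulr_suml expr2.
apply: ler_sum => i _; rewrite (bigD1 i)//= [X in _ + X]big1 ?addr0; last first.
  by move=> j ji; rewrite product_weight_indep 1?eq_sym// EZ mul0r.
rewrite (@product_weight_marginal i (fun s => Z i s * Z i s)).
rewrite -[leRHS]mul1r -(q_sum i) mulr_suml; apply: ler_sum => s _.
apply: ler_wpM2l => //; rewrite -expr2 exprMn ler_piMr ?sqr_ge0//.
have q1 : q i r <= 1.
  by rewrite -(q_sum i) (bigD1 r)//= lerDl; apply: sumr_ge0.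
rewrite -(@real_normK _ (_ - _)) ?num_real// expr_le1// ler_norml.
by have := q_ge0 i r; case: eqP => _ /=; lra.
Qed.

End product_laws.

(** * Change of measure *)

Section change_of_measure.
Context (R : realType) (X : finType).

(** Convexity in the form used instead of Jensen's inequality: summing or integrating a tangent line
    needs only linearity. *)
Lemma expR_tangent (x y : R) : expR y + expR y * (x - y) <= expR x.
Proof.
have -> : expR x = expR y * expR (x - y) by rewrite -expRD addrC subrK.
by rewrite -{1}[expR y]mulr1 -mulrDr ler_wpM2l ?expR_ge0// expR_ge1Dx.
Qed.

(* Splitting the relative entropy of [q] with respect to [p] over [E] and its
   complement, the tangent inequality bounds the first part from below by
   [b ln (b / p E)] and the second one by [- 1]. *)
Lemma change_of_measure (p q L : X -> R) (E : pred X) (H : R) :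
  (forall x, 0 < p x) -> \sum_x p x = 1 ->
  (forall x, 0 <= q x) -> (forall x, 0 < q x -> q x = p x * expR (L x)) ->
  \sum_x q x * L x <= H ->
  forall b, b = \sum_(x | E x) q x -> 0 < b ->
  b * expR (- (H + 1) / b) <= \sum_(x | E x) p x.
Proof.
move=> p0 p1 q0 qL qH b bE b0.
have key (s : R) x : q x + q x * s - p x * expR s <= q x * L x.
  have := q0 x; rewrite le_eqVlt => /predU1P[<-|qx0].
    by rewrite !mul0r addr0 sub0r oppr_le0 mulr_ge0 ?expR_ge0// ltW.
  have := expR_tangent s (L x); rewrite -(ler_pM2l (p0 x)) mulrDr mulrA -qL//.
  by rewrite mulrBr; lra.
have [x0 Ex0] : exists x0, E x0.
  apply: contrapT => /forallNP nE; move: b0; rewrite bE big1 ?ltxx// => x Ex.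
  by have := nE x.
set pE := \sum_(x | E x) p x.
have pE0 : 0 < pE.
  rewrite /pE (bigD1 x0)//= ltr_pwDl//.
  by apply: sumr_ge0 => x _; apply/ltW/p0.
(* For [s = ln (b / pE)] the sums over [E] of [q x] and of [p x * expR s] both equal [b] and cancel.
   On the complement [s = 0] is enough. *)
have pEb : b * ln (b / pE) <= \sum_(x | E x) q x * L x.
  have -> : b * ln (b / pE) =
      \sum_(x | E x) (q x + q x * ln (b / pE) - p x * expR (ln (b / pE))).
    rewrite sumrB big_split/= -!mulr_suml -bE -/pE lnK ?posrE ?divr_gt0//.
    by rewrite mulrC; field; rewrite gt_eqF.
  by apply: ler_sum => x _; exact: key.
have pEc : - 1 <= \sum_(x | ~~ E x) q x * L x.
  have pc : pE + \sum_(x | ~~ E x) p x = 1 by rewrite -p1 [RHS](bigID E).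
  have : \sum_(x | ~~ E x) - p x <= \sum_(x | ~~ E x) q x * L x.
    apply: ler_sum => x _; have := key 0 x.
    by rewrite expR0 mulr0 mulr1 addr0; have := q0 x; lra.
  by rewrite sumrN; lra.
have bln : b * ln (b / pE) <= H + 1.
  by move: qH; rewrite (bigID E)/=; lra.
rewrite -ler_pdivlMl// -/pE (mulrC b^-1).
have -> : pE / b = expR (- ln (b / pE)).
  by rewrite expRN lnK ?posrE ?divr_gt0// invf_div.
rewrite ler_expR mulNr lerN2 ler_pdivlMr// mulrC; exact: bln.
Qed.

End change_of_measure.

(** * Integrals against weights with values in [0, 1] *)

Section real_integrals.
Context d (T : measurableType d) (R : realType).
Variables (mu : {measure set T -> \bar R}) (D : set T).
Hypothesis mD : measurable D.
Local Notation intg f := (mu.-integrable D (EFin \o f)).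
Implicit Types f g w : T -> R.

Lemma EFin_integrableD f g : intg f -> intg g -> intg (fun x => f x + g x).
Proof. exact: integrableD. Qed.

Lemma EFin_integrableB f g : intg f -> intg g -> intg (fun x => f x - g x).
Proof. exact: integrableB. Qed.

Lemma EFin_integrableZ (k : R) f : intg f -> intg (fun x => k * f x).
Proof. exact: integrableZl. Qed.

Lemma EFin_integrable_sum I (s : seq I) (P : pred I) (f : I -> T -> R) :
  (forall i, P i -> intg (f i)) -> intg (fun x => \sum_(i <- s | P i) f i x).
Proof.
move=> fi; rewrite (_ : _ \o _ = fun x => \sum_(i <- s | P i) (f i x)%:E)%E.
  exact: (integrable_sum mD).
by apply/funext => x /=; rewrite sumEFin.
Qed.

Lemma Rintegral_sum I (s : seq I) (P : pred I) (f : I -> T -> R) :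
  (forall i, P i -> intg (f i)) ->
  \int[mu]_(x in D) (\sum_(i <- s | P i) f i x) =
  \sum_(i <- s | P i) \int[mu]_(x in D) f i x.
Proof.
move=> fi; elim: s => [|i s IH].
  rewrite big_nil; under eq_Rintegral do rewrite big_nil.
  by rewrite Rintegral_cst// mul0r.
rewrite big_cons; under eq_Rintegral do rewrite big_cons.
case: ifPn => [Pi|//]; rewrite RintegralD ?IH//; first exact: fi.
exact: EFin_integrable_sum.
Qed.

Definition weight w := measurable_fun D w /\ (forall x, D x -> 0 <= w x <= 1).

Lemma integrableM_weight f w : intg f -> weight w -> intg (fun x => f x * w x).
Proof.
move=> fi [mw w01]; apply: (le_integrable mD _ _ fi) => /=.
  apply/measurable_EFinP; apply: measurable_funM => //.
  by apply/measurable_EFinP; exact: measurable_int fi.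
move=> x Dx; rewrite lee_fin normrM ler_piMr// ger0_norm.
  by case/andP: (w01 x Dx).
by case/andP: (w01 x Dx).
Qed.

Lemma integrable_cst_EFin (k : R) : (mu D < +oo)%E -> intg (cst k).
Proof.
move=> Doo; apply: measurable_bounded_integrable => //.
by exists `|k|; split; rewrite ?num_real// => M /ltW kM x _.
Qed.

Lemma weight_integrable w : (mu D < +oo)%E -> weight w -> intg w.
Proof.
move=> Doo ww; rewrite (_ : w = fun x => cst 1 x * w x); last first.
  by apply/funext => x; rewrite mul1r.
by apply: integrableM_weight => //; exact: integrable_cst_EFin.
Qed.

Lemma weight_indic (A : set T) : measurable A -> weight (\1_A).
Proof.
move=> mA; split; first exact: measurable_indic.
by move=> x _; rewrite indicE; case: (_ \in _); rewrite /= lexx ler01.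
Qed.

(** The bound does not depend on [w], so [f] may be replaced by an L^1 approximation before any
    limit in [w] is taken. *)
Lemma Rintegral_weight_close f g w : intg f -> intg g -> weight w ->
  `|\int[mu]_(x in D) (f x * w x) - \int[mu]_(x in D) (g x * w x)|
  <= \int[mu]_(x in D) `|f x - g x|.
Proof.
move=> fi gi ww; rewrite -RintegralB//; [|exact: integrableM_weight..].
have fgi := EFin_integrableB fi gi.
apply: le_trans (le_normr_Rintegral _ _) _ => //.
  by apply: EFin_integrableB; exact: integrableM_weight.
apply: le_Rintegral => //.
- by apply: integrable_norm; apply: EFin_integrableB; exact: integrableM_weight.
- exact: (integrable_norm fgi).
- move=> x Dx; rewrite -mulrBl normrM ler_piMr// ger0_norm.
    by case/andP: (ww.2 x Dx).
  by case/andP: (ww.2 x Dx).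
Qed.

Section disjoint_unions.
Variable B : (set T)^nat.
Hypotheses (mB : forall i, measurable (B i)) (tB : trivIset setT B).

Lemma sum_indic_le n x : \sum_(i < n) \1_(B i) x <= \1_(\bigcup_k B k) x :> R.
Proof.
have [[k Bkx]|nB] := pselect (exists k : 'I_n, B k x).
  rewrite (bigD1 k)//= big1 ?addr0 => [|j jk].
    by rewrite !indicE mem_set// mem_set//; exists (k : nat).
  rewrite indicE memNset// => Bjx; move/eqP: jk; apply; apply: val_inj.
  by apply: tB => //; exists x.
rewrite big1 ?indicE ?ler0n// => j _; rewrite indicE memNset// => Bjx.
by apply: nB; exists j.
Qed.

(** Countable additivity as L^1 convergence: the same tail then controls the integrals against all
    weights at once. *)
Lemma cvg_indic_bigcup : (mu D < +oo)%E ->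
  \int[mu]_(x in D) (\1_(\bigcup_k B k) x - \sum_(i < n) \1_(B i) x)
    @[n --> \oo] --> 0.
Proof.
move=> Doo.
have mU : measurable (\bigcup_k B k) by exact: bigcup_measurable.
have integrable_ind A : measurable A -> intg (\1_A : T -> R).
  by move=> mA; exact/weight_integrable/weight_indic.
have intB A : measurable A -> \int[mu]_(x in D) \1_A x = fine (mu (A `&` D)).
  by move=> mA; rewrite /Rintegral integral_indic.
have fin A : measurable A -> mu (A `&` D) \is a fin_num.
  move=> mA; rewrite ge0_fin_numE//; apply: le_lt_trans Doo.
  by apply: le_measure; rewrite ?inE//; exact: measurableI.
have : (\sum_(0 <= i < n) mu (B i `&` D))%E @[n --> \oo] -->
    (fine (mu ((\bigcup_k B k) `&` D)))%:E.
  rewrite fineK ?fin// setI_bigcupl; apply: measure_semi_sigma_additive.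
  - by move=> i; exact: measurableI.
  - exact: trivIset_setIr.
  - by rewrite -setI_bigcupl; exact: measurableI.
move/fine_cvgP => [_ H].
rewrite -[X in _ --> X](subrr (fine (mu ((\bigcup_k B k) `&` D)))).
apply: cvg_trans; last by apply: cvgB H; exact: cvg_cst.
apply: near_eq_cvg; near=> n => /=.
rewrite RintegralB//; [|exact: integrable_ind|]; last first.
  by apply: EFin_integrable_sum => // i _; exact: integrable_ind.
rewrite Rintegral_sum//; last by move=> i _; exact: integrable_ind.
rewrite intB//; under eq_bigr do rewrite intB//.
rewrite sum_fine => [|i _]; last exact: fin.
by rewrite -(big_mkord xpredT (fun i => mu (B i `&` D))).
Unshelve. all: by end_near. Qed.

End disjoint_unions.

End real_integrals.

(** * Limits of integrals against converging weights *)

Section weighted_convergence.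
Context d (T : measurableType d) (R : realType).
Variables (mu : {measure set T -> \bar R}) (D : set T).
Hypotheses (mD : measurable D) (Doo : (mu D < +oo)%E).
Local Notation intg f := (mu.-integrable D (EFin \o f)).
Context (G : Type) (F : set_system G) {FF : Filter F}.
Variables (w : G -> T -> R) (w0 : T -> R).
Hypotheses (ww : \forall g \near F, weight D (w g)) (ww0 : weight D w0).

(** The good test functions. They form a linear space that is closed in L^1. *)
Let C (f : T -> R) := intg f /\
  (\int[mu]_(x in D) (f x * w g x) @[g --> F] --> \int[mu]_(x in D) (f x * w0 x)).

Let C_closed f : intg f ->
  (forall e, 0 < e -> exists2 f', C f' & \int[mu]_(x in D) `|f x - f' x| <= e) ->
  C f.
Proof.
move=> fi fC; split=> //; apply/cvgrPdist_le => e e0.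
have [f' [fi' Cf'] ff'] := fC (e / 3) ltac:(lra).
move/cvgrPdist_le : Cf' => /(_ (e / 3) ltac:(lra)) H.
near=> g.
have h1 := le_trans (Rintegral_weight_close mD fi fi' ww0) ff'.
have h2 : `|\int[mu]_(x in D) (f x * w g x) - \int[mu]_(x in D) (f' x * w g x)| <= e / 3.
  by apply: le_trans ff'; apply: Rintegral_weight_close => //; near: g.
have h3 : `|\int[mu]_(x in D) (f' x * w0 x) - \int[mu]_(x in D) (f' x * w g x)| <= e / 3.
  by near: g.
rewrite -[X in `|X|](_ : (\int[mu]_(x in D) (f x * w0 x) - \int[mu]_(x in D) (f' x * w0 x))
  - (\int[mu]_(x in D) (f x * w g x) - \int[mu]_(x in D) (f' x * w g x))
  + (\int[mu]_(x in D) (f' x * w0 x) - \int[mu]_(x in D) (f' x * w g x)) = _); last by lra.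
have := ler_normD (\int[mu]_(x in D) (f x * w0 x) - \int[mu]_(x in D) (f' x * w0 x)
  - (\int[mu]_(x in D) (f x * w g x) - \int[mu]_(x in D) (f' x * w g x)))
  (\int[mu]_(x in D) (f' x * w0 x) - \int[mu]_(x in D) (f' x * w g x)).
have := ler_normB (\int[mu]_(x in D) (f x * w0 x) - \int[mu]_(x in D) (f' x * w0 x))
  (\int[mu]_(x in D) (f x * w g x) - \int[mu]_(x in D) (f' x * w g x)).
lra.
Unshelve. all: by end_near. Qed.

Let CD f g : C f -> C g -> C (fun x => f x + g x).
Proof.
move=> [fi Cf] [gi Cg]; split; first exact: EFin_integrableD.
have eqD v : weight D v -> \int[mu]_(x in D) ((f x + g x) * v x) =
    \int[mu]_(x in D) (f x * v x) + \int[mu]_(x in D) (g x * v x).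
  move=> wv; under eq_Rintegral do rewrite mulrDl.
  by rewrite RintegralD//; exact: integrableM_weight.
rewrite eqD//; apply: cvg_trans; last exact: cvgD Cf Cg.
by apply: near_eq_cvg; near=> h; rewrite eqD//; near: h.
Unshelve. all: by end_near. Qed.

Let CZ (k : R) f : C f -> C (fun x => k * f x).
Proof.
move=> [fi Cf]; split; first exact: EFin_integrableZ.
have eqZ v : weight D v -> \int[mu]_(x in D) ((k * f x) * v x) =
    k * \int[mu]_(x in D) (f x * v x).
  move=> wv; under eq_Rintegral do rewrite -mulrA.
  by rewrite RintegralZl//; exact: integrableM_weight.
rewrite eqZ//; apply: cvg_trans; last exact: cvgMl_tmp Cf.
by apply: near_eq_cvg; near=> h; rewrite eqZ//; near: h.
Unshelve. all: by end_near. Qed.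

Let C0 : C (fun=> 0).
Proof.
split; first exact: (integrable0 mu).
under eq_cvg do under eq_Rintegral do rewrite mul0r.
by under eq_Rintegral do rewrite mul0r; exact: cvg_cst.
Qed.

Let C_sum I (s : seq I) (f : I -> T -> R) :
  (forall i, C (f i)) -> C (fun x => \sum_(i <- s) f i x).
Proof.
move=> Cf; elim: s => [|i s IH].
  by rewrite (_ : (fun _ => _) = fun=> 0) //; apply/funext => x; rewrite big_nil.
rewrite (_ : (fun _ => _) = fun x => f i x + \sum_(j <- s) f j x); first exact: CD.
by apply/funext => x; rewrite big_cons.
Qed.

Let integrable_ind A : measurable A -> intg (\1_A : T -> R).
Proof. by move=> mA; exact/weight_integrable/weight_indic. Qed.

Variable P : set (set T).
Hypotheses (PE : @measurable _ T = <<s P >>) (PI : setI_closed P).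
Hypothesis cvgT :
  \int[mu]_(x in D) w g x @[g --> F] --> \int[mu]_(x in D) w0 x.
Hypothesis cvgP : forall A, P A ->
  \int[mu]_(x in D) (\1_A x * w g x) @[g --> F] --> \int[mu]_(x in D) (\1_A x * w0 x).

Let C1 : C (fun=> 1).
Proof.
split; first exact: integrable_cst_EFin.
under eq_cvg do under eq_Rintegral do rewrite mul1r.
by under eq_Rintegral do rewrite mul1r.
Qed.

Let C_measurable A : measurable A -> C \1_A.
Proof.
have Pm B : P B -> measurable B by rewrite PE; exact: sub_sigma_algebra.
rewrite [X in X A -> _]PE; move: A.
apply: (dynkin_induction PE PI) => [|A|B mB CB|B mB tB CB].
- by rewrite indicT.
- by move=> PA; split; [exact/integrable_ind/Pm|exact: cvgP].
- rewrite (_ : \1_(~` B) = fun x => 1 + (-1) * \1_B x :> R).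
    by exact: (CD C1 (CZ (-1) CB)).
  by apply/funext => x; rewrite !indicE in_setC; case: (_ \in _);
    rewrite ?mulr0 ?addr0 ?mulr1 ?subrr.
apply: C_closed => [|e e0]; first exact/integrable_ind/bigcup_measurable.
have /cvgrPdist_le/(_ e e0)[n _ /(_ n (leqnn n))/= H] :=
  cvg_indic_bigcup mD mB tB Doo.
exists (fun x => \sum_(i < n) \1_(B i) x); first exact: C_sum.
under eq_Rintegral do rewrite ger0_norm ?subr_ge0 ?sum_indic_le//.
by apply: le_trans H; rewrite sub0r normrN; exact: ler_norm.
Qed.

(** It is enough to test on a generating class [P] stable under intersection: Dynkin induction gives
    all indicators, linearity the simple functions, and L^1 density the rest. Below, [P] is in turn
    the boxes, all measurable sets and the half-lines. *)
Lemma weighted_cvg f : intg f ->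
  \int[mu]_(x in D) (f x * w g x) @[g --> F] --> \int[mu]_(x in D) (f x * w0 x).
Proof.
move=> fi; suff : C f by case.
apply: C_closed => // e e0.
have [s [si _]] := approximation_sfun_integrable mD fi.
move/fine_cvgP => [_ /cvgrPdist_le /(_ e e0)[n _ /(_ n (leqnn n))/= H]].
exists (s n); last first.
  by apply: le_trans H; rewrite sub0r normrN /comp; apply: ler_norm.
pose t := fset_set (range (s n)).
have : C (fun x => \sum_(i < #|`t|) t`_i * \1_(s n @^-1` [set t`_i]) x).
  apply: C_sum => i; apply: CZ; apply: C_measurable.
  exact: measurable_sfunP.
by congr C; apply/funext => x; rewrite fimfunEord.
Qed.

End weighted_convergence.

(** * Weak convergence and continuity of the kernel functional *)

Section power_measures.
Context d (T : measurableType d) (R : realType).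
Variable mu : {sigma_finite_measure set T -> \bar R}.

Definition box n (A : 'I_n -> set T) : set (n.-tuple T) :=
  [set x | forall i, A i (tnth x i)].

Lemma measurable_box n (A : 'I_n -> set T) :
  (forall i, measurable (A i)) -> measurable (box A).
Proof.
move=> mA; rewrite (_ : box A = \bigcap_(i in [set: 'I_n])
    ((fun x => tnth x i) @^-1` A i)); last first.
  by apply/seteqP; split => x /= H i => [_|]; apply: H.
apply: fin_bigcap_measurable => [|i _]; first exact: finite_finset.
by rewrite -[X in measurable X]setTI; exact: measurable_tnth.
Qed.

Lemma measurable_tuple_box n :
  @measurable _ (n.-tuple T) =
  <<s [set B | exists2 A, (forall i, measurable (A i)) & B = @box n A] >>.
Proof.
apply/seteqP; split; last first.
  apply: smallest_sub; first exact: sigma_algebra_measurable.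
  by move=> B [A mA ->]; exact: measurable_box.
apply: smallest_sub; first exact: smallest_sigma_algebra.
apply: (big_ind (fun E => E `<=` _)) => [//|E E' EP EP' B [/EP|/EP']//|j _].
move=> B [A mA <-{B}]; apply: sub_sigma_algebra.
exists (fun k => if k == j then A else setT) => [k|]; first by case: ifP.
rewrite setTI; apply/seteqP; split=> x /= Ax; last by have := Ax j; rewrite eqxx.
by move=> k; case: eqP => // ->.
Qed.

Lemma setI_closed_box n :
  setI_closed [set B | exists2 A, (forall i, measurable (A i)) & B = @box n A].
Proof.
move=> _ _ [A mA ->] [B mB ->]; exists (fun i => A i `&` B i).
  by move=> i; exact: measurableI.
by apply/seteqP; split=> x /= => [[Ax Bx] i|ABx]; [split|split=> i; case: (ABx i)].
Qed.

Lemma ge0_integral_power_measure n (u : 'I_n -> T -> R) :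
  (forall i, measurable_fun setT (u i)) -> (forall i x, 0 <= u i x) ->
  (\int[power_measure mu n]_x (\prod_(i < n) u i (tnth x i))%:E =
   \prod_(i < n) \int[mu]_x (u i x)%:E)%E.
Proof.
elim: n u => [|n IHn] u mu_ u0.
  rewrite big_ord0 /= integral_dirac//.
    by rewrite diracE mem_set// mul1e big_ord0.
  by under eq_fun do rewrite big_ord0; exact: measurable_cst.
have mprod : measurable_fun setT
    (fun x : n.+1.-tuple T => (\prod_(i < n.+1) u i (tnth x i))%:E).
  apply/measurable_EFinP; apply: measurable_prod => i _.
  by apply: measurableT_comp => //; exact: measurable_tnth.
have mprod' : measurable_fun setT
    (fun x : n.-tuple T => (\prod_(i < n) u (lift ord0 i) (tnth x i))%:E).
  apply/measurable_EFinP; apply: measurable_prod => i _.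
  by apply: measurableT_comp => //; exact: measurable_tnth.
rewrite /= /power_step ge0_integral_pushforward//; last 2 first.
  exact: measurable_cons_pair.
  by move=> x _; rewrite lee_fin; apply: prodr_ge0.
rewrite preimage_setT /comp.
rewrite fubini_tonelli1; last 2 first.
  exact: (measurableT_comp mprod (@measurable_cons_pair _ T n)).
  by move=> x; rewrite lee_fin; apply: prodr_ge0.
rewrite big_ord_recl -IHn//.
rewrite -ge0_integralZr//.
  apply: eq_integral => x _; rewrite /fubini_F -ge0_integralZl_EFin//; last first.
    by move=> t _; rewrite lee_fin; apply: prodr_ge0.
  apply: eq_integral => t _; rewrite big_ord_recl tnth0 EFinM.
  by under eq_bigr do rewrite tnthS.
- exact/measurable_EFinP.
- by move=> x _; rewrite lee_fin.
- by apply: integral_ge0 => t _; rewrite lee_fin; apply: prodr_ge0.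
Qed.

Lemma weight_prod n (D : set T) (w : 'I_n -> T -> R) :
  measurable D -> (forall i, weight D (w i)) ->
  weight (box (fun=> D)) (fun x : n.-tuple T => \prod_(i < n) w i (tnth x i)).
Proof.
move=> mD ww; split.
  apply: measurable_prod => i _; have [mw _] := ww i.
  apply: (measurable_comp _ _ mw) => //.
    by move=> _ [x Dx <-]; exact: Dx.
  by apply: measurable_funTS; exact: measurable_tnth.
move=> x Dx; have w01 i := (ww i).2 _ (Dx i).
rewrite prodr_ge0 => [|i _]; last by case/andP: (w01 i).
by apply: prodr_ile1 => i; rewrite w01.
Qed.

Lemma Rintegral_power_measure n (D : set T) (w : 'I_n -> T -> R) :
  measurable D -> (mu D < +oo)%E -> (forall i, weight D (w i)) ->
  \int[power_measure mu n]_(x in box (fun=> D)) \prod_(i < n) w i (tnth x i) =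
  \prod_(i < n) \int[mu]_(x in D) w i x.
Proof.
move=> mD Doo ww; rewrite Rintegral_mkcond.
(* Extending each factor by 0 outside [D] extends the product by 0 outside the box, which reduces to
   an integral over the whole space. *)
have -> : (fun x : n.-tuple T => \prod_(i < n) w i (tnth x i)) \_ (box (fun=> D))
    = fun x => \prod_(i < n) (w i \_ D) (tnth x i).
  apply/funext => x; rewrite patchE; case: ifPn => [|nDx].
    rewrite inE => Dx; apply: eq_bigr => i _; rewrite patchE ifT// inE; exact: Dx.
  have [i nDi] : exists i, tnth x i \notin D.
    apply: contrapT => /forallNP H; move: nDx; rewrite notin_setE; apply => i.
    by have /negP := H i; rewrite negbK inE.
  by rewrite (bigD1 i)//= patchE (negPf nDi) mul0r.
transitivity (fine (\int[power_measure mu n]_x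
    (\prod_(i < n) (w i \_ D) (tnth x i))%:E)%E); first by [].
rewrite (ge0_integral_power_measure (u := fun i => w i \_ D)); last 2 first.
- by move=> i; apply/(measurable_restrictT _ mD); exact: (ww i).1.
- move=> i x; rewrite patchE; case: ifPn => //; rewrite inE => Dx.
  by case/andP: ((ww i).2 _ Dx).
have Ei i : (\int[mu]_x ((w i \_ D) x)%:E = (\int[mu]_(x in D) w i x)%:E)%E.
  rewrite Rintegral_mkcond /Rintegral fineK//.
  have := integrable_fin_num mD (weight_integrable mD Doo (ww i)).
  by rewrite integral_mkcond restrict_EFin.
under eq_bigr do rewrite Ei.
by rewrite prodEFin.
Qed.

End power_measures.

Section weak_convergence.
Context (R : realType) (c : nat).
Local Notation mu := (@lebesgue_measure R).
Local Notation I01 := (`[0, 1]%classic : set (measurableTypeR R)).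

(** Weak-star convergence in L^infinity as the dual of L^1, coordinate by coordinate. Stated for
    filters, it covers ultrafilters as well as convergence in probability. *)
Definition weak_cvg (F : set_system (R -> 'rV[R]_c)) (f : R -> 'rV[R]_c) :=
  forall (r : 'I_c) (phi : R -> R), mu.-integrable I01 (EFin \o phi) ->
    (fun g : R -> 'rV[R]_c => \int[mu]_(u in I01) (phi u * g u ord0 r)) @ F -->
    \int[mu]_(u in I01) (phi u * f u ord0 r).

Lemma color_fun_weight (f : R -> 'rV[R]_c) r :
  color_fun f -> weight I01 (fun u => f u ord0 r).
Proof. by case=> mf f01 _; split; [exact: mf|move=> x xI; exact: (f01 x xI r)]. Qed.

Lemma unit_interval_finite : (mu I01 < +oo)%E.
Proof. by rewrite /= lebesgue_measure_itv /= lte_fin ltr01 oppr0 adde0 ltry. Qed.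

Lemma cubeE v : @cube R v = box (fun=> I01). Proof. by []. Qed.

Lemma measurable_cube v : measurable (@cube R v).
Proof. by rewrite cubeE; exact: measurable_box. Qed.

Lemma cube_finite v : (@lebesgue_power R v (@cube R v) < +oo)%E.
Proof.
rewrite /lebesgue_power cubeE power_measure_box//.
rewrite /= lebesgue_measure_itv /= lte_fin ltr01 oppr0 adde0.
by rewrite big1_eq ltry.
Qed.

(** The product of the [g (tnth x a)] is itself a weight on the cube, and [W] plays the test
    function. Over a box the integral factors into one-dimensional integrals, to which weak
    convergence applies. *)
Lemma kernel_functional_cvg v (W : v.-tuple (measurableTypeR R) -> R) r
    (F : set_system (R -> 'rV[R]_c)) {FF : Filter F} (f : R -> 'rV[R]_c) :
  (@lebesgue_power R v).-integrable (@cube R v) (EFin \o W) ->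
  (\forall g \near F, color_fun g) -> color_fun f -> weak_cvg F f ->
  kernel_functional W g ord0 r @[g --> F] --> kernel_functional W f ord0 r.
Proof.
move=> iW Fc fc Ff; rewrite mxE.
rewrite (_ : (fun g => _) = fun g : R -> 'rV[R]_c =>
    \int[@lebesgue_power R v]_(x in @cube R v) (W x * \prod_(a < v) g (tnth x a) ord0 r)); last by apply/funext => g; rewrite mxE.
have mI : measurable I01 by exact: measurable_itv.
have wcol g : color_fun g -> weight (@cube R v)
    (fun x => \prod_(a < v) g (tnth x a) ord0 r).
  move=> gc; apply: (weight_prod (D := I01) (w := fun _ u => g u ord0 r)) => // a.
  exact: color_fun_weight.
have intE g : color_fun g -> forall A : 'I_v -> set (measurableTypeR R),
    (forall a, measurable (A a)) ->
    \int[@lebesgue_power R v]_(x in @cube R v)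
        (\1_(box A) x * \prod_(a < v) g (tnth x a) ord0 r) =
    \prod_(a < v) \int[mu]_(u in I01) (\1_(A a) u * g u ord0 r).
  move=> gc A mA.
  rewrite -(Rintegral_power_measure (w := fun a u => \1_(A a) u * g u ord0 r))//; last 2 first.
  - exact: unit_interval_finite.
  - move=> a; have [mg g01] := color_fun_weight r gc; split.
      by apply: measurable_funM => //; exact: measurable_indic.
    move=> u u01; rewrite indicE; case: (_ \in _); rewrite ?mul0r ?mul1r ?lexx ?ler01//.
    exact: g01.
  apply: eq_Rintegral => x _; rewrite big_split/=; congr (_ * _).
  rewrite indicE; case: (boolP (x \in box A)) => [|nAx].
    by rewrite inE => Ax; rewrite big1// => a _; rewrite indicE mem_set//; exact: Ax.
  have [a nAa] : exists a, tnth x a \notin A a.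
    apply: contrapT => /forallNP H; move: nAx; rewrite notin_setE; apply => a.
    by have /negP := H a; rewrite negbK inE.
  by rewrite (bigD1 a)//= indicE (negPf nAa) mul0r.
have cvgbox (A : 'I_v -> set (measurableTypeR R)) : (forall a, measurable (A a)) ->
    (fun g : R -> 'rV[R]_c => \int[@lebesgue_power R v]_(x in @cube R v)
        (\1_(box A) x * \prod_(a < v) g (tnth x a) ord0 r)) @ F -->
    \int[@lebesgue_power R v]_(x in @cube R v)
        (\1_(box A) x * \prod_(a < v) f (tnth x a) ord0 r).
  move=> mA; rewrite intE//.
  pose E (g : R -> 'rV[R]_c) := \prod_(a < v)
    \int[mu]_(u in I01) (\1_(A a) u * g u ord0 r).
  apply: (@cvg_trans _ (E @ F)).
    by apply: near_eq_cvg; near=> g; apply/esym/intE => //; near: g.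
  apply: cvg_big => [|a _]; first exact: mul_continuous.
  apply: Ff; apply: weight_integrable => //; first exact: unit_interval_finite.
  exact: weight_indic.
apply: (weighted_cvg (@measurable_cube v) (@cube_finite v)
  (w := fun (g : R -> 'rV[R]_c) x => \prod_(a < v) g (tnth x a) ord0 r) _ (wcol f fc)
  (@measurable_tuple_box _ _ v) (@setI_closed_box _ _ v) _ _ iW).
- by near=> g; apply: wcol; near: g.
- have := cvgbox (fun=> setT) (fun=> measurableT).
  have -> : box (fun=> setT) = [set: v.-tuple (measurableTypeR R)].
    by apply/seteqP; split.
  rewrite indicT; under eq_cvg do under eq_Rintegral do rewrite mul1r.
  by under eq_Rintegral do rewrite mul1r.
- by move=> _ [A mA ->]; exact: cvgbox.
Unshelve. all: by end_near. Qed.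

End weak_convergence.

(** * Step functions of colorings *)

Section cells.
Context (R : realType) (n : nat).
Hypothesis n_gt0 : (0 < n)%N.
Local Notation mu := (@lebesgue_measure R).
Local Notation I01 := (`[0, 1]%classic : set (measurableTypeR R)).

(** The rounding is the one of [step_kernel], so that colorings and tensors are step functions on
    the same cells. *)
Definition cell (i : 'I_n) : set (measurableTypeR R) :=
  [set x | 0 <= x <= 1 /\ Num.max (Num.ceil (n%:R * x)) 1 = i.+1%:Z].

Let nR : 0 < n%:R :> R. Proof. by rewrite ltr0n. Qed.

(** [BSide true] is a closed left endpoint: because of the maximum with 1 in [cell], the first cell,
    and only this one, contains its left end. *)
Lemma cellE (i : 'I_n) :
  cell i = [set` Interval (BSide ((i : nat) == 0%N) (i%:R / n%:R : R))
                          (BRight (i.+1%:R / n%:R))].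
Proof.
have iS : i.+1%:Z - 1 = i by rewrite -addn1 PoszD addrK.
have i1 : i.+1%:R / n%:R <= 1 :> R by rewrite ler_pdivrMr// mul1r ler_nat.
apply/seteqP; split=> x /=; rewrite in_itv/=; case: eqVneq => [i0|i0] /=.
- rewrite i0 mul0r => -[/andP[x0 _] maxE]; rewrite x0/= ler_pdivlMr// mulrC.
  have : (Num.ceil (n%:R * x) <= i.+1%:Z)%R by rewrite -maxE le_max lexx.
  by rewrite i0 ceil_le_int.
- move=> [_ maxE]; have : Num.ceil (n%:R * x) == i.+1%:Z.
    move: maxE; rewrite /Num.max; case: ifP => [_ [] E|_ -> //].
    by move: i0; rewrite -E eqxx.
  rewrite ceil_eq iS => /andP[]; rewrite ltr_pdivrMr// ler_pdivlMr//.
  by rewrite ![_ * n%:R]mulrC => -> ->.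
- rewrite i0 mul0r => /andP[x0 x1]; split; first by rewrite x0 (le_trans x1)// -i0.
  rewrite max_r ?i0//; rewrite ceil_le_int.
  by rewrite mulrC -ler_pdivlMr.
- move=> /andP[x0 x1]; split.
    by rewrite (le_trans x1 i1) andbT (le_trans _ (ltW x0))// divr_ge0// ltW.
  have /eqP -> : Num.ceil (n%:R * x) == i.+1%:Z.
    by rewrite ceil_eq iS mulrC -ltr_pdivrMr// x0 -ler_pdivlMr// x1.
  by rewrite max_l.
Qed.

Lemma measurable_cell i : measurable (cell i).
Proof. by rewrite cellE; exact: measurable_itv. Qed.

Lemma cell_sub i : cell i `<=` I01.
Proof. by move=> x [x01 _]; rewrite /= in_itv. Qed.

Lemma lebesgue_cell i : mu (cell i) = (n%:R^-1)%:E.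
Proof.
rewrite cellE lebesgue_measure_itv/= lte_fin ltr_pM2r ?invr_gt0// ltr_nat ltnSn.
by rewrite -EFinB -mulrBl -natrB// subSnn mul1r.
Qed.

Lemma cell_inj i j x : cell i x -> cell j x -> i = j.
Proof. by move=> [_ ei] [_]; rewrite ei => -[/val_inj]. Qed.

Lemma cell_cover x : I01 x -> exists i, cell i x.
Proof.
rewrite /= in_itv/= => x01.
have [m mE] : exists m : nat, Num.max (Num.ceil (n%:R * x)) 1 = m.+1%:Z.
  have : 1 <= Num.max (Num.ceil (n%:R * x)) 1 by rewrite le_max lexx orbT.
  by case: (Num.max _ _) => [[|m]|m]//; exists m.
have mn : (m < n)%N.
  rewrite -lez_nat -mE ge_max lez_nat n_gt0 andbT ceil_le_int.
  by case/andP: x01 => _ x1; rewrite ler_piMr// ler0n.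
by exists (Ordinal mn); split.
Qed.

(** Every cell has length [n%:R^-1], so the average of [phi] over it is [n%:R * cell_int phi i]. *)
Definition cell_int (phi : R -> R) (i : 'I_n) : R :=
  \int[mu]_(u in I01) (phi u * \1_(cell i) u).

Local Notation intg f := (mu.-integrable I01 (EFin \o f)).

Let mI : measurable I01. Proof. exact: measurable_itv. Qed.
Let Ioo := @unit_interval_finite R.

Lemma integrable_cell phi i : intg phi -> intg (fun u => phi u * \1_(cell i) u).
Proof.
move=> ip; apply: integrableM_weight => //.
by apply: weight_indic; exact: measurable_cell.
Qed.

Lemma sum_indic_cell x : I01 x -> \sum_(i < n) \1_(cell i) x = 1 :> R.
Proof.
move=> /cell_cover[i ix]; rewrite (bigD1 i)//= indicE mem_set// big1 ?addr0//.
by move=> j ji; rewrite indicE memNset// => /(cell_inj ix) ij; rewrite ij eqxx in ji.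
Qed.

Lemma cell_int_sum phi : intg phi ->
  \sum_(i < n) cell_int phi i = \int[mu]_(u in I01) phi u.
Proof.
move=> ip; rewrite -Rintegral_sum// => [|i _]; last exact: integrable_cell.
apply: eq_Rintegral => u; rewrite inE => uI.
by rewrite -mulr_sumr sum_indic_cell// mulr1.
Qed.

Lemma cell_int_cst k i : cell_int (fun=> k) i = k / n%:R.
Proof.
rewrite /cell_int RintegralZl//; last first.
  apply: weight_integrable => //.
  by apply: weight_indic; exact: measurable_cell.
rewrite /Rintegral integral_indic//; last exact: measurable_cell.
rewrite (setIidl (@cell_sub i)).
exact: (congr1 (fun x => k * fine x) (lebesgue_cell i)).
Qed.

Lemma cell_intD phi psi i : intg phi -> intg psi ->
  cell_int (fun u => phi u + psi u) i = cell_int phi i + cell_int psi i.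
Proof.
move=> ip iq; rewrite /cell_int -RintegralD//; [|exact: integrable_cell..].
by apply: eq_Rintegral => u _; rewrite mulrDl.
Qed.

Lemma cell_intZ k phi i : intg phi ->
  cell_int (fun u => k * phi u) i = k * cell_int phi i.
Proof.
move=> ip; rewrite /cell_int -RintegralZl//; last exact: integrable_cell.
by apply: eq_Rintegral => u _; rewrite mulrA.
Qed.

Lemma cell_int_sumr I (s : seq I) (phi : I -> R -> R) i : (forall j, intg (phi j)) ->
  cell_int (fun u => \sum_(j <- s) phi j u) i = \sum_(j <- s) cell_int (phi j) i.
Proof.
move=> ip; rewrite /cell_int -Rintegral_sum//; last by move=> j _; exact: integrable_cell.
by apply: eq_Rintegral => u _; rewrite mulr_suml.
Qed.

Lemma le_cell_int phi psi i : intg phi -> intg psi ->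
  (forall u, I01 u -> phi u <= psi u) -> cell_int phi i <= cell_int psi i.
Proof.
move=> ip iq le; apply: le_Rintegral => //; [exact: integrable_cell..|].
by move=> u /le; apply: ler_wpM2r; rewrite indicE.
Qed.

Lemma cell_int_weight w i : weight I01 w -> 0 <= cell_int w i <= n%:R^-1.
Proof.
move=> ww; have iw := weight_integrable mI Ioo ww.
have icst k : intg (fun=> k) by exact: integrable_cst_EFin.
have := le_cell_int i (icst 0) iw (fun u uI => proj1 (andP (ww.2 u uI))).
have := le_cell_int i iw (icst 1) (fun u uI => proj2 (andP (ww.2 u uI))).
by rewrite !cell_int_cst mul0r mul1r => -> ->.
Qed.

(** Integrate over the cell the tangent to the exponential at the average [q] of [lam]: its linear
    part integrates to 0. *)
Lemma cell_int_expR lam i : intg lam -> intg (expR \o lam) ->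
  expR (n%:R * cell_int lam i) <= n%:R * cell_int (expR \o lam) i.
Proof.
move=> il iel; set q := n%:R * cell_int lam i.
have icst k : intg (fun=> k) by exact: integrable_cst_EFin.
have itan : intg (fun u => (expR q - expR q * q) + expR q * lam u).
  by apply: EFin_integrableD => //; exact: EFin_integrableZ.
have : cell_int (fun u => (expR q - expR q * q) + expR q * lam u) i
    <= cell_int (expR \o lam) i.
  by apply: le_cell_int => // u _; have := expR_tangent (lam u) q; rewrite /= mulrBr; lra.
rewrite cell_intD//; last exact: EFin_integrableZ.
rewrite cell_intZ// cell_int_cst => /(ler_wpM2l (ltW nR)).
rewrite mulrDr mulrCA divff ?gt_eqF// mulr1 mulrCA -/q; lra.
Qed.

(** The left side is the tangent at [q] of the convex function [y ln y]. Since [0 * ln 0 = 0], the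
    endpoint [y = 0] is included. *)
Lemma xlnx_tangent (y q : R) : 0 <= y -> 0 < q -> y * ln q + y - q <= y * ln y.
Proof.
rewrite le_eqVlt => /predU1P[<-|y0] q0; first by rewrite !mul0r; lra.
have := expR_tangent (ln q) (ln y); rewrite !lnK ?posrE//.
have := ln_div q0 y0.
nra.
Qed.

Lemma xlnx_bound (y : R) : 0 <= y <= 1 -> 0 <= - (y * ln y) <= 1.
Proof.
move=> /andP[y0 y1]; have := xlnx_tangent y0 ltr01; rewrite ln1 mulr0 add0r => h.
have : y * ln y <= 0 by rewrite mulr_ge0_le0// ln_le0.
by move=> h'; apply/andP; split; lra.
Qed.

(** Hence the entropy density of a color function is bounded and integrable, and entropies are real
    numbers. *)
Lemma weight_xlnx (w : R -> R) : weight I01 w -> weight I01 (fun u => - (w u * ln (w u))).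
Proof.
move=> [mw w01]; split; last by move=> u uI; exact/xlnx_bound/w01.
apply: measurableT_comp => //; apply: measurable_funM => //.
by apply: measurableT_comp => //; exact: measurable_ln.
Qed.

Lemma integrable_xlnx (w : R -> R) : weight I01 w -> intg (fun u => w u * ln (w u)).
Proof.
move=> /weight_xlnx/(weight_integrable mI Ioo)/(EFin_integrableZ mI (-1)).
by congr (_.-integrable _ _); apply/funext => u /=; rewrite mulN1r opprK.
Qed.

Lemma cell_int_xlnx (w : R -> R) i : weight I01 w ->
  n%:R * cell_int w i * ln (n%:R * cell_int w i) <=
  n%:R * cell_int (fun u => w u * ln (w u)) i.
Proof.
set q := n%:R * _; move=> ww; have iw := weight_integrable mI Ioo ww.
have ix := integrable_xlnx ww.
have q0 : 0 <= q by rewrite mulr_ge0//; case/andP: (cell_int_weight i ww).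
have icst k : intg (fun=> k) by exact: integrable_cst_EFin.
have H p : 0 < p -> q * ln p + q - p <= n%:R * cell_int (fun u => w u * ln (w u)) i.
  move=> p0; have : cell_int (fun u => - p + (ln p + 1) * w u) i
      <= cell_int (fun u => w u * ln (w u)) i.
    apply: le_cell_int => //.
      by apply: EFin_integrableD => //; exact: EFin_integrableZ.
    move=> u uI; have /andP[wu0 _] := ww.2 u uI.
    by have := xlnx_tangent wu0 p0; rewrite (mulrC (ln p + 1)) mulrDr mulr1; lra.
  rewrite cell_intD//; last exact: EFin_integrableZ.
  rewrite cell_intZ// cell_int_cst => /(ler_wpM2l (ltW nR)).
  rewrite mulrDr mulrCA divff ?gt_eqF// mulr1 mulrCA -/q mulrDl mul1r; lra.
(* There is no tangent at an average equal to 0; tangents at [e] with [e] tending to 0 replace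
   it. *)
move: q0; rewrite le_eqVlt => /predU1P[q0|q0]; last by have := H _ q0; lra.
rewrite -q0 mul0r; apply/ler_addgt0Pr => e e0.
by have := H e e0; rewrite -q0 mul0r; lra.
Qed.

End cells.

Section color_steps.
Context (R : realType) (c n : nat).
Hypothesis n_gt0 : (0 < n)%N.
Local Notation mu := (@lebesgue_measure R).
Local Notation I01 := (`[0, 1]%classic : set (measurableTypeR R)).
Local Notation intg f := (mu.-integrable I01 (EFin \o f)).
Implicit Types (X : n.-tuple 'I_c).
Let mI : measurable I01. Proof. exact: measurable_itv. Qed.
Let Ioo := @unit_interval_finite R.

Definition color_step X (x : R) : 'rV[R]_c :=
  \row_r \sum_(i < n) (tnth X i == r)%:R * \1_(cell i) x.

Lemma color_step_cell X i x r : cell i x ->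
  color_step X x ord0 r = (tnth X i == r)%:R.
Proof.
move=> ix; rewrite mxE (bigD1 i)//= indicE mem_set// mulr1 big1 ?addr0//.
by move=> j ji; rewrite indicE memNset ?mulr0// => /(cell_inj ix) ij; rewrite ij eqxx in ji.
Qed.

Lemma color_fun_step X : color_fun (color_step X).
Proof.
split=> [r||].
- rewrite (_ : (fun x => _) = fun x =>
      \sum_(i < n) (tnth X i == r)%:R * \1_(@cell R n i) x); last first.
    by apply/funext => x; rewrite mxE.
  apply: measurable_sum => i; apply: measurable_funM => //.
  by apply: measurable_indic; exact: measurable_cell.
- move=> x /(cell_cover n_gt0)[i ix] r; rewrite (color_step_cell _ _ ix).
  by case: eqP; rewrite lexx ler01.
- move=> x /(cell_cover n_gt0)[i ix].
  under eq_bigr do rewrite (color_step_cell _ _ ix).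
  rewrite (bigD1 (tnth X i))//= eqxx big1 ?addr0// => r /negPf.
  by rewrite eq_sym => ->.
Qed.

Lemma Rintegral_color_step X phi r : intg phi ->
  \int[mu]_(u in I01) (phi u * color_step X u ord0 r) =
  \sum_(i < n) (tnth X i == r)%:R * cell_int phi i.
Proof.
move=> ip; under eq_bigr do rewrite -(cell_intZ n_gt0)//.
rewrite /cell_int -Rintegral_sum//; last first.
  by move=> i _; apply: integrable_cell => //; exact: EFin_integrableZ.
apply: eq_Rintegral => u _; rewrite mxE mulr_sumr; apply: eq_bigr => i _.
by rewrite mulrCA mulrA.
Qed.

Lemma mean_color_step X : mean (color_step X) = proportions R X.
Proof.
apply/rowP => r; rewrite !mxE; have := Rintegral_color_step X r
  (integrable_cst_EFin mI 1 Ioo).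
under eq_Rintegral do rewrite mul1r; move=> ->.
by rewrite mulr_sumr; apply: eq_bigr => i _; rewrite cell_int_cst// mul1r mulrC.
Qed.

End color_steps.

(** * Weak compactness *)

Section ultrafilters.
Context (R : realType) (G : Type) (U : set_system G) {UU : UltraFilter U}.

(** The segment provides a cluster point, and a cluster point of an ultrafilter is a limit, since
    one of [B] and its complement always belongs to it. *)
Lemma ultra_cvg (phi : G -> R) (a b : R) : (\forall g \near U, a <= phi g <= b) ->
  cvg (phi @ U).
Proof.
move=> phiab; have [|p [_ clp]] := @segment_compact R a b (phi @ U) _.
  by apply: filterS phiab => g; rewrite /= in_itv.
apply/cvg_ex; exists p => B pB.
have [//|UnB] := in_ultra_setVsetC (phi @^-1` B) UU.
have [x []//] := clp (~` B) B UnB pB.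
Qed.

End ultrafilters.

Section weak_compactness.
Context (R : realType) (c : nat).
Local Notation mu := (@lebesgue_measure R).
Local Notation I01 := (`[0, 1]%classic : set (measurableTypeR R)).
Local Notation intg f := (mu.-integrable I01 (EFin \o f)).
Context (U : set_system (R -> 'rV[R]_c)) {UU : UltraFilter U}.
Hypothesis Uc : \forall g \near U, color_fun g.
Let mI : measurable I01. Proof. exact: measurable_itv. Qed.
Let Ioo := @unit_interval_finite R.

Section density.
Variable r : 'I_c.

Let part (g : R -> 'rV[R]_c) (A : set (measurableTypeR R)) : R :=
  \int[mu]_(u in I01) (\1_A u * g u ord0 r).

Let ind_intg (A : set (measurableTypeR R)) : measurable A -> intg (\1_A : R -> R).
Proof. by move=> mA; exact/(weight_integrable mI Ioo)/weight_indic. Qed.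

Let part_intg g (A : set (measurableTypeR R)) :
  color_fun g -> measurable A ->
  intg (fun u => \1_A u * g u ord0 r).
Proof.
move=> gc mA; apply: integrableM_weight => //; first exact: ind_intg.
exact: color_fun_weight.
Qed.

Let part_bound g A : color_fun g -> measurable A ->
  0 <= part g A <= \int[mu]_(u in I01) \1_A u.
Proof.
move=> gc mA; apply/andP; split.
  apply: Rintegral_ge0 => u uI; rewrite mulr_ge0//.
  by have [_ /(_ u uI r)/andP[]] := gc.
apply: le_Rintegral => //; [exact: part_intg|exact: ind_intg|].
by move=> u uI; rewrite ler_piMr//; have [_ /(_ u uI r)/andP[]] := gc.
Qed.

Definition limit_part A : R := lim (part ^~ A @ U).

Let limit_partP A : measurable A -> part ^~ A @ U --> limit_part A.
Proof.
move=> mA; apply: (ultra_cvg (a := 0) (b := \int[mu]_(u in I01) \1_A u)).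
by near=> g; apply: part_bound => //; near: g.
Unshelve. all: by end_near. Qed.

(* The absolute value only matters on non-measurable sets, where [lim] may be junk. *)
Definition limit_measure (A : set (measurableTypeR R)) : \bar R :=
  `|limit_part A|%:E.

Let limit_part_bound A : measurable A ->
  0 <= limit_part A <= \int[mu]_(u in I01) \1_A u.
Proof.
move=> mA; apply/andP; split.
  apply: (limr_ge (limit_partP mA)); near=> g.
  have gc : color_fun g by near: g.
  by case/andP: (part_bound gc mA).
apply: (limr_le (limit_partP mA)); near=> g.
have gc : color_fun g by near: g.
by case/andP: (part_bound gc mA).
Unshelve. all: by end_near. Qed.

Let abs_limit_part A : measurable A -> `|limit_part A| = limit_part A.
Proof. by move=> mA; rewrite ger0_norm//; case/andP: (limit_part_bound mA). Qed.

Let limit_measure0 : limit_measure set0 = 0%E.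
Proof.
rewrite /limit_measure abs_limit_part//; congr EFin; apply/eqP; rewrite eq_le.
have /andP[-> h] := @limit_part_bound set0 measurable0.
rewrite andbT (le_trans h)//; under eq_Rintegral do rewrite indic0.
by rewrite Rintegral_cst// mul0r.
Qed.

Let limit_measure_ge0 A : (0 <= limit_measure A)%E.
Proof. by rewrite /limit_measure lee_fin. Qed.

Let limit_measure_sigma_additive : semi_sigma_additive limit_measure.
Proof.
move=> B mB tB mU; rewrite /limit_measure.
rewrite (_ : (fun n => _) = fun n => (\sum_(i < n) limit_part (B i))%:E); last first.
  apply/funext => n; rewrite sumEFin big_mkord; congr EFin.
  by apply: eq_bigr => i _; rewrite abs_limit_part.
rewrite abs_limit_part//; apply: cvg_EFin; first exact: nearW.
pose t n := \int[mu]_(x in I01) (\1_(\bigcup_k B k) x - \sum_(i < n) \1_(B i) x).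
have t0 : t n @[n --> \oo] --> 0 by exact: cvg_indic_bigcup.
(* The bound [t n] on the tails is the same for all [g], so it survives the limit along [U]. This is
   the exchange of limits behind countable additivity. *)
have bound n : 0 <= limit_part (\bigcup_k B k) - \sum_(i < n) limit_part (B i) <= t n.
  have partsum g : color_fun g ->
      0 <= part g (\bigcup_k B k) - \sum_(i < n) part g (B i) <= t n.
    move=> gc; have gi A := @part_intg g A gc.
    rewrite -Rintegral_sum//; last by move=> i _; exact: gi.
    have sI : intg (fun x => \sum_(i < n) (\1_(B i) x * g x ord0 r)).
      by apply: EFin_integrable_sum => // i _; exact: gi.
    rewrite -RintegralB//; last exact: gi.
    have iB : intg (fun x => \1_(\bigcup_k B k) x - \sum_(i < n) \1_(B i) x).
      apply: EFin_integrableB => //; first exact: ind_intg.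
      by apply: EFin_integrable_sum => // i _; exact: ind_intg.
    apply/andP; split.
      apply: Rintegral_ge0 => x xI; rewrite -mulr_suml -mulrBl mulr_ge0//.
        by rewrite subr_ge0; exact: sum_indic_le.
      by have [_ /(_ x xI r)/andP[]] := gc.
    apply: le_Rintegral => //; first by apply: EFin_integrableB => //; exact: gi.
    move=> x xI; rewrite -mulr_suml -mulrBl ler_piMr//.
      by rewrite subr_ge0; exact: sum_indic_le.
    by have [_ /(_ x xI r)/andP[]] := gc.
  have cv : (fun g => part g (\bigcup_k B k) - \sum_(i < n) part g (B i)) @ U -->
      limit_part (\bigcup_k B k) - \sum_(i < n) limit_part (B i).
    apply: cvgB; first exact: limit_partP.
    apply: cvg_big => [|i _]; first exact: add_continuous.
    exact: limit_partP.
  apply/andP; split.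
    rewrite -(cvg_lim _ cv)//; apply: limr_ge; first by apply/cvg_ex; eexists; exact: cv.
    near=> g; have gc : color_fun g by near: g.
    by case/andP: (partsum g gc).
  rewrite -(cvg_lim _ cv)//; apply: limr_le; first by apply/cvg_ex; eexists; exact: cv.
  near=> g; have gc : color_fun g by near: g.
    by case/andP: (partsum g gc).
apply/cvgrPdist_le => e e0; move/cvgrPdist_le : t0 => /(_ e e0).
apply: filterS => n; rewrite sub0r normrN => /(le_trans (ler_norm _)) tne.
by have /andP[b0 b1] := bound n; rewrite ger0_norm// (le_trans b1).
Unshelve. all: by end_near. Qed.

HB.instance Definition _ := isMeasure.Build _ _ _ limit_measure
  limit_measure0 limit_measure_ge0 limit_measure_sigma_additive.

Let limit_measure_fin : fin_num_fun limit_measure.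
Proof. by []. Qed.

HB.instance Definition _ := @Measure_isFinite.Build _ _ _ limit_measure limit_measure_fin.

Lemma limit_density : exists h : R -> R, [/\ forall u, 0 <= h u,
  mu.-integrable setT (EFin \o h) &
  forall A, measurable A ->
    (fun g : R -> 'rV[R]_c => \int[mu]_(u in I01) (\1_A u * g u ord0 r)) @ U -->
    \int[mu]_(u in I01) (\1_A u * h u)].
Proof.
have dom : limit_measure `<< mu.
  apply/null_content_dominatesP => A mA A0; rewrite /limit_measure abs_limit_part//.
  congr EFin; apply/eqP; rewrite eq_le; have /andP[-> h] := limit_part_bound mA.
  have AI0 : mu (A `&` I01) = 0%E.
    apply/eqP; rewrite eq_le measure_ge0 andbT -A0.
    by apply: le_measure; rewrite ?inE//; exact: measurableI.
  rewrite andbT (le_trans h)// /Rintegral integral_indic//.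
  by rewrite [X in fine X](_ : _ = 0%E).
have [h [h0 hfin hint hE]] := radon_nikodym_sigma_finite dom.
exists (fine \o h); have fineh : EFin \o (fine \o h) = h.
  by apply/funext => u /=; rewrite fineK.
split; [by move=> u; rewrite fine_ge0|by rewrite fineh|].
move=> A mA; rewrite (_ : \int[mu]_(u in I01) (\1_A u * (fine \o h) u) = limit_part A).
  exact: limit_partP.
(* The density is defined on the whole line but is only integrated over the unit interval;
   [limit_part] does not see the rest of [A]. *)
have -> : limit_part A = limit_part (A `&` I01).
  congr (lim (_ @ U)); apply/funext => g; apply: eq_Rintegral => u uI.
  by rewrite !indicE in_setI uI andbT.
have mAI : measurable (A `&` I01) by exact: measurableI.
apply: EFin_inj; rewrite -(abs_limit_part mAI) -[RHS]/(limit_measure (A `&` I01)) hE//.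
rewrite -(fineK (_ : (\int[mu]_(x in A `&` I01) h x)%E \is a fin_num)); last first.
  by rewrite -hE.
rewrite -fineh setIC -[X in _ = X%:E]/(Rintegral mu (I01 `&` A) (fine \o h)).
rewrite Rintegral_mkcondr; congr EFin; apply: eq_Rintegral => u uI.
by rewrite patchE indicE; case: ifP => _; rewrite ?mul1r ?mul0r.
Qed.

End density.

Lemma weak_compact : exists2 f, color_fun f & weak_cvg U f.
Proof.
pose hP r h := [/\ forall u, 0 <= h u, mu.-integrable setT (EFin \o h) &
  forall A, measurable A ->
    (fun g : R -> 'rV[R]_c => \int[mu]_(u in I01) (\1_A u * g u ord0 r)) @ U -->
    \int[mu]_(u in I01) (\1_A u * h u)].
have [h hh] : exists h : 'I_c -> R -> R, forall r, hP r (h r).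
  have ch r : {h : R -> R | hP r h} by apply: cid; exact: limit_density.
  by exists (fun r => sval (ch r)) => r; exact: svalP.
have h0 r u : 0 <= h r u by have [] := hh r.
have hI r : intg (h r).
  by have [_ + _] := hh r; apply: integrableS => //; exact: measurableT.
have mh r : measurable_fun I01 (h r).
  by apply/measurable_EFinP; exact: measurable_int (hI r).
have hcvg r A (mA : measurable A) := let: And3 _ _ P := hh r in P A mA.
pose H u := \sum_(r < c) h r u.
have HI : intg H by apply: EFin_integrable_sum.
have mH : measurable_fun I01 H by apply/measurable_EFinP; exact: measurable_int HI.
have hmul r (A : set (measurableTypeR R)) : measurable A -> intg (fun u => \1_A u * h r u).
  move=> mA; rewrite (_ : (fun u => _) = fun u => h r u * \1_A u).
    by apply: integrableM_weight => //; exact: weight_indic.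
  by apply/funext => u; rewrite mulrC.
(* The constraint that the colors sum to 1 is linear, so it passes to the limit in integrated form,
   over every measurable set. *)
have HE A : measurable A ->
    \int[mu]_(u in I01) (\1_A u * H u) = \int[mu]_(u in I01) \1_A u.
  move=> mA; have c1 : (fun g : R -> 'rV[R]_c =>
      \sum_(r < c) \int[mu]_(u in I01) (\1_A u * g u ord0 r)) @ U -->
      \sum_(r < c) \int[mu]_(u in I01) (\1_A u * h r u).
    apply: cvg_big => [|r _]; first exact: add_continuous.
    exact: hcvg.
  have c2 : (fun g : R -> 'rV[R]_c =>
      \sum_(r < c) \int[mu]_(u in I01) (\1_A u * g u ord0 r)) @ U -->
      \int[mu]_(u in I01) \1_A u.
    apply: cvg_near_cst; near=> g.
    have gc : color_fun g by near: g.
    rewrite -Rintegral_sum//; last first.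
      move=> r _; apply: integrableM_weight => //; last exact: color_fun_weight.
      by apply: weight_integrable => //; exact: weight_indic.
    apply: eq_Rintegral => u; rewrite inE => uI; rewrite -mulr_sumr.
    by have [_ _ ->] := gc; rewrite ?mulr1.
  rewrite -(cvg_unique _ c1 c2)// -Rintegral_sum//; last by move=> r _; exact: hmul.
  by apply: eq_Rintegral => u _; rewrite mulr_sumr.
have H1 : ae_eq mu I01 (EFin \o H) (EFin \o cst 1).
  apply: integral_ae_eq => //; first exact/measurable_EFinP.
  move=> A AI mA; have iHA : mu.-integrable A (EFin \o H) by apply: integrableS HI.
  have iA : mu.-integrable A (EFin \o cst 1).
    by apply: (integrableS mI) => //; exact: integrable_cst_EFin.
  rewrite -(fineK (integrable_fin_num mA iHA)) -(fineK (integrable_fin_num mA iA)).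
  congr EFin.
  have IE (f : R -> R) : \int[mu]_(u in I01) (\1_A u * f u) = \int[mu]_(u in A) f u.
    rewrite -[in RHS](setIidr AI) Rintegral_mkcondr; apply: eq_Rintegral => u uI.
    by rewrite patchE indicE; case: ifP => _; rewrite ?mul1r ?mul0r.
  apply: etrans (esym (IE H)) (etrans (HE A mA) (etrans _ (IE (cst 1)))).
  by apply: eq_Rintegral => u _; rewrite mulr1.
(* The densities sum to 1 only almost everywhere; elsewhere any color function will do. Where they
   do sum to 1, nonnegativity forces each of them to be at most 1. *)
have [g0 g0c] : exists g0 : R -> 'rV[R]_c, color_fun g0 := filter_ex Uc.
pose f u : 'rV[R]_c := if H u == 1 then \row_r h r u else g0 u.
have fE u r : f u ord0 r = if H u == 1 then h r u else g0 u ord0 r.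
  by rewrite /f; case: ifP; rewrite ?mxE.
have fc : color_fun f.
  split=> [r|u uI r|u uI].
  - rewrite (_ : (fun u => _) = fun u => if H u == 1 then h r u else g0 u ord0 r).
      apply: measurable_fun_if => //.
      + by apply: measurable_fun_eqr => //; exact: measurable_cst.
      + by apply: measurable_funS (mh r).
      + by apply: measurable_funS (color_fun_weight r g0c).1.
    exact/funext.
  - rewrite fE; case: ifP => [/eqP H1u|_]; last by have [_ g01 _] := g0c; exact: g01.
    rewrite h0/= -H1u /H (bigD1 r)//= lerDl; exact: sumr_ge0.
  - case: (eqVneq (H u) 1) => [H1u|/negPf H1u].
      by under eq_bigr do rewrite fE H1u eqxx.
    by under eq_bigr do rewrite fE H1u; have [_ _] := g0c; exact.
have fh r A : measurable A ->
    \int[mu]_(u in I01) (\1_A u * h r u) = \int[mu]_(u in I01) (\1_A u * f u ord0 r).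
  move=> mA; congr fine; apply: ae_eq_integral => //.
  - exact: measurable_int (hmul r A mA).
  - have : intg (fun u => \1_A u * f u ord0 r).
      apply: integrableM_weight => //; last exact: color_fun_weight.
      by apply: weight_integrable => //; exact: weight_indic.
    exact: measurable_int.
  - apply: filterS H1 => u /= H1u uI; rewrite fE.
    by have := H1u uI => -[->]; rewrite eqxx.
have Ph r A : measurable A ->
    (fun g : R -> 'rV[R]_c => \int[mu]_(u in I01) (\1_A u * g u ord0 r)) @ U -->
    \int[mu]_(u in I01) (\1_A u * f u ord0 r).
  by move=> mA; rewrite -fh//; exact: hcvg.
exists f => // r phi iphi.
apply: (weighted_cvg mI Ioo (w := fun (g : R -> 'rV[R]_c) u => g u ord0 r) _
  (color_fun_weight r fc) (P := measurable) _ _ _ _ iphi).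
- by near=> g; apply: color_fun_weight; near: g.
- by rewrite sigma_algebra_id//; exact: sigma_algebra_measurable.
- by move=> A B; exact: measurableI.
- have := Ph r setT measurableT; rewrite indicT.
  under eq_Rintegral do rewrite mul1r.
  rewrite (_ : (fun g => _) = fun g : R -> 'rV[R]_c => \int[mu]_(u in I01) g u ord0 r)//.
  by apply/funext => g; under eq_Rintegral do rewrite mul1r.
- by move=> A mA; exact: Ph.
Unshelve. all: by end_near. Qed.
End weak_compactness.

(** * Relative entropy *)

Section duality.
Context (R : realType) (c : nat).
Local Notation mu := (@lebesgue_measure R).
Local Notation I01 := (`[0, 1]%classic : set (measurableTypeR R)).
Local Notation intg f := (mu.-integrable I01 (EFin \o f)).
Local Notation colors := (R -> 'rV[R]_c).
Implicit Types (f : colors).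
Let mI : measurable I01. Proof. exact: measurable_itv. Qed.
Let Ioo := @unit_interval_finite R.

Variable p : 'rV[R]_c.
Hypotheses (p_gt0 : forall r, 0 < p ord0 r) (p_sum : \sum_(r < c) p ord0 r = 1).

(** The relative entropy of the law [f u] with respect to [p], integrated over [u]. The expanded
    form is the one that matches the rate function. *)
Definition relative_entropy (f : colors) : R :=
  entropy f - \sum_(r < c) ln (p ord0 r) * mean f ord0 r.

Definition pairing (lam : 'I_c -> R -> R) (f : colors) : R :=
  \sum_(r < c) \int[mu]_(u in I01) (lam r u * f u ord0 r).

(* The test functions of the variational formula
   [relative_entropy f = sup_lam pairing lam f]. *)
Definition tilting (lam : 'I_c -> R -> R) : Prop :=
  [/\ forall r, intg (lam r), forall r, intg (expR \o lam r) &
      forall u, I01 u -> \sum_(r < c) p ord0 r * expR (lam r u) = 1].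

Let colorI f r : color_fun f -> intg (fun u => f u ord0 r).
Proof. by move=> fc; apply: weight_integrable => //; exact: color_fun_weight. Qed.

Let xlnxI f r : color_fun f -> intg (fun u => f u ord0 r * ln (f u ord0 r)).
Proof. by move=> fc; apply: integrable_xlnx; exact: color_fun_weight. Qed.

Lemma relative_entropyE f : color_fun f ->
  relative_entropy f = \int[mu]_(u in I01)
    \sum_(r < c) (f u ord0 r * ln (f u ord0 r) - ln (p ord0 r) * f u ord0 r).
Proof.
move=> fc; rewrite /relative_entropy /entropy.
under [in RHS]eq_Rintegral do rewrite sumrB.
rewrite RintegralB//; last 2 first.
- by apply: EFin_integrable_sum => // r _; exact: xlnxI.
- by apply: EFin_integrable_sum => // r _; apply: EFin_integrableZ => //; exact: colorI.
congr (_ - _); rewrite Rintegral_sum//; last first.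
  by move=> r _; apply: EFin_integrableZ => //; exact: colorI.
by apply: eq_bigr => r _; rewrite mxE RintegralZl//; exact: colorI.
Qed.

Lemma pairing_le lam f : tilting lam -> color_fun f ->
  pairing lam f <= relative_entropy f.
Proof.
move=> [ilam iexp lam1] fc; rewrite relative_entropyE// /pairing -Rintegral_sum//; last first.
  by move=> r _; apply: integrableM_weight => //; exact: color_fun_weight.
apply: le_Rintegral => //.
- apply: EFin_integrable_sum => // r _; apply: integrableM_weight => //.
  exact: color_fun_weight.
- apply: EFin_integrable_sum => // r _; apply: EFin_integrableB => //; first exact: xlnxI.
  by apply: EFin_integrableZ => //; exact: colorI.
move=> u uI; have [_ f01 f1] := fc.
rewrite -subr_ge0 -sumrB.
(* Both [f u] and the tilted law are probability vectors, so the first-order terms of the tangents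
   to [y ln y] at the tilted law cancel in the sum. *)
rewrite -[leLHS](_ : \sum_(r < c) (f u ord0 r - p ord0 r * expR (lam r u)) = 0); last first.
  by rewrite sumrB lam1// f1// subrr.
apply: ler_sum => r _; have /andP[fr0 _] := f01 u uI r.
have := xlnx_tangent fr0 (mulr_gt0 (p_gt0 r) (expR_gt0 (lam r u))).
rewrite lnM ?posrE ?expR_gt0// expRK mulrDr; lra.
Qed.

Lemma tilting0 : tilting (fun _ _ => 0).
Proof.
split=> [r|r|u _]; [exact: integrable_cst_EFin|exact: integrable_cst_EFin|].
by under eq_bigr do rewrite expR0 mulr1.
Qed.

Lemma relative_entropy_ge0 f : color_fun f -> 0 <= relative_entropy f.
Proof.
move=> fc; apply: le_trans (pairing_le tilting0 fc); rewrite /pairing big1// => r _.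
by under eq_Rintegral do rewrite mul0r; rewrite Rintegral_cst// mul0r.
Qed.

(* The optimal tilting is [ln (f / p)]; mixing [f] with [p] keeps it bounded. *)
Lemma tilting_exists f (e : R) : color_fun f -> 0 < e ->
  exists2 lam, tilting lam & relative_entropy f - e <= pairing lam f.
Proof.
(* With this [d], [ln (1 - d) = - e]: discarding the part [d] of the mixture lowers the logarithm by
   exactly [e]. *)
move=> fc e0; pose d := 1 - expR (- e); have d1 : 1 - d = expR (- e) by rewrite /d; lra.
have d01 : 0 < d < 1.
  have := expR_gt0 (- e); have : expR (- e) < 1 by rewrite expR_lt1 oppr_lt0.
  by rewrite /d => h1 h2; apply/andP; split; lra.
pose z r u := (1 - d) * (f u ord0 r / p ord0 r) + d.
pose lam r u := ln (z r u); have [mf f01 f1] := fc.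
have zb r u : I01 u -> d <= z r u <= (p ord0 r)^-1 + 1.
  move=> uI; have /andP[fr0 fr1] := f01 u uI r.
  have q0 : 0 <= f u ord0 r / p ord0 r by rewrite divr_ge0// ltW.
  have q1 : f u ord0 r / p ord0 r <= (p ord0 r)^-1.
    by rewrite ler_piMl// invr_ge0 ltW.
  move: d01 => /andP[d0 d1'].
  have h1 : 0 <= (1 - d) * (f u ord0 r / p ord0 r) by rewrite mulr_ge0//; lra.
  have h2 : (1 - d) * (f u ord0 r / p ord0 r) <= f u ord0 r / p ord0 r.
    by rewrite ler_piMl//; lra.
  by rewrite /z; lra.
have z0 r u : I01 u -> 0 < z r u.
  by move=> /(zb r)/andP[+ _]; apply: lt_le_trans; case/andP: d01.
have mz r : measurable_fun I01 (z r).
  apply: measurable_funD => //; apply: measurable_funM => //.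
  by apply: measurable_funM => //; exact: mf.
have bounded_intg (g : R -> R) (K : R) : measurable_fun I01 g ->
    (forall u, I01 u -> `|g u| <= K) -> intg g.
  move=> mg gK; apply: measurable_bounded_integrable => //.
  exists K; split; rewrite ?num_real// => M /ltW KM u uI.
  by apply: le_trans KM; exact: gK.
have mlam r : measurable_fun I01 (lam r).
  by apply: measurableT_comp (mz r); exact: measurable_ln.
have ilam r : intg (lam r).
  apply: (bounded_intg _ (`|ln d| + `|ln ((p ord0 r)^-1 + 1)|)).
    exact: mlam.
  move=> u uI; have /andP[zd zp] := zb r u uI.
  have d0 : 0 < d by case/andP: d01.
  have l1 : ln d <= lam r u by rewrite /lam ler_ln ?posrE//; exact: z0.
  have l2 : lam r u <= ln ((p ord0 r)^-1 + 1).
    by rewrite /lam ler_ln ?posrE//; [exact: z0|rewrite addr_gt0 ?invr_gt0].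
  rewrite ler_norml; have := ler_norm (- ln d); rewrite normrN.
  have := ler_norm (ln ((p ord0 r)^-1 + 1)).
  have := normr_ge0 (ln d); have := normr_ge0 (ln ((p ord0 r)^-1 + 1)).
  by move=> *; apply/andP; split; lra.
have lamf r : intg (fun u => lam r u * f u ord0 r).
  by apply: integrableM_weight => //; exact: color_fun_weight.
have ient : intg (fun u => \sum_(r < c)
    (f u ord0 r * ln (f u ord0 r) - ln (p ord0 r) * f u ord0 r)).
  apply: EFin_integrable_sum => // r _; apply: EFin_integrableB => //; first exact: xlnxI.
  by apply: EFin_integrableZ => //; exact: colorI.
exists lam.
  split=> // [r|u uI].
    apply: (bounded_intg _ ((p ord0 r)^-1 + 1)).
      by apply: measurableT_comp (mlam r); exact: measurable_expR.
    move=> u uI; rewrite /= /lam lnK ?posrE; last exact: z0.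
    by rewrite gtr0_norm; [case/andP: (zb r u uI)|exact: z0].
  under eq_bigr => r _.
    rewrite /lam lnK ?posrE; last exact: z0.
    rewrite /z mulrDr mulrCA (mulrC (f u ord0 r)) mulVKf ?gt_eqF//.
    over.
  by rewrite big_split/= -mulr_sumr -mulr_suml f1// p_sum mulr1 mul1r subrK.
rewrite relative_entropyE// /pairing -Rintegral_sum//.
have mu1 : fine (mu I01) = 1.
  by rewrite /= lebesgue_measure_itv/= lte_fin ltr01 oppr0 adde0.
have icst : intg (cst e) by exact: integrable_cst_EFin.
have := Rintegral_cst mu mI e; rewrite [X in _ = _ * X]mu1 mulr1 => eE.
rewrite -[X in _ - X]eE -RintegralB//; apply: le_Rintegral => //.
- exact: EFin_integrableB.
- exact: EFin_integrable_sum.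
move=> u uI; rewrite -[e]mulr1 -(f1 u uI) mulr_sumr -sumrB; apply: ler_sum => r _.
have /andP[+ _] := f01 u uI r; rewrite le_eqVlt => /predU1P[<-|fr0].
  by rewrite !(mul0r, mulr0) !subr0.
have d1' : 0 < 1 - d by rewrite d1 expR_gt0.
have : ln ((1 - d) * (f u ord0 r / p ord0 r)) <= lam r u.
  rewrite /lam ler_ln ?posrE; [|by rewrite mulr_gt0// divr_gt0|exact: z0].
  by rewrite lerDl; case/andP: d01 => /ltW.
rewrite lnM ?posrE ?divr_gt0// ln_div ?posrE// d1 expRK => /(ler_wpM2l (ltW fr0)).
by rewrite (mulrC (lam r u)); apply: le_trans; lra.
Qed.

End duality.

(** * Exponential upper bounds *)

Section asymptotics.
Context (R : realType) (c : nat).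
Local Notation mu := (@lebesgue_measure R).
Local Notation I01 := (`[0, 1]%classic : set (measurableTypeR R)).
Local Notation intg f := (mu.-integrable I01 (EFin \o f)).
Local Notation colors := (R -> 'rV[R]_c).
Implicit Types (f g : colors) (P : set colors) (FF : set_system colors).
Let mI : measurable I01. Proof. exact: measurable_itv. Qed.
Let Ioo := @unit_interval_finite R.

(* The neighborhoods of [f] among color functions, for the weak topology. *)
Definition weak_nbhs f P : Prop := forall FF : set_system colors,
  Filter FF -> FF (@color_fun R c) -> weak_cvg FF f -> FF P.

Lemma pairing_cvg lam f FF {fFF : Filter FF} : (forall r, intg (lam r)) ->
  weak_cvg FF f -> pairing lam @ FF --> pairing lam f.
Proof.
move=> ilam wFF; rewrite /pairing; apply: cvg_big => [|r _]; first exact: add_continuous.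
exact: wFF.
Qed.

Lemma pairing_color_step n (X : n.-tuple 'I_c) lam : (0 < n)%N ->
  (forall r, intg (lam r)) ->
  pairing lam (color_step X) = \sum_(i < n) cell_int (lam (tnth X i)) i.
Proof.
move=> n0 ilam; rewrite /pairing.
under eq_bigr do rewrite Rintegral_color_step//.
rewrite exchange_big; apply: eq_bigr => i _.
rewrite (bigD1 (tnth X i))//= eqxx mul1r big1 ?addr0// => r /negPf.
by rewrite eq_sym => ->; rewrite mul0r.
Qed.

Variable p : 'rV[R]_c.
Hypotheses (p_gt0 : forall r, 0 < p ord0 r) (p_sum : \sum_(r < c) p ord0 r = 1).

Lemma iid_weight_ge0 n (x : n.-tuple 'I_c) : 0 <= \prod_(i < n) p ord0 (tnth x i).
Proof. by apply: prodr_ge0 => i _; exact/ltW/p_gt0. Qed.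

Lemma iid_expect_le n (F F' : n.-tuple 'I_c -> R) : (forall x, F x <= F' x) ->
  iid_expect p F <= iid_expect p F'.
Proof.
by move=> le; apply: ler_sum => x _; apply: ler_wpM2l => //; exact: iid_weight_ge0.
Qed.

Lemma iid_expectD n (F F' : n.-tuple 'I_c -> R) :
  iid_expect p (fun x => F x + F' x) = iid_expect p F + iid_expect p F'.
Proof. by rewrite /iid_expect -big_split; apply: eq_bigr => x _; rewrite mulrDr. Qed.

Lemma iid_expectZ n k (F : n.-tuple 'I_c -> R) :
  iid_expect p (fun x => k * F x) = k * iid_expect p F.
Proof. by rewrite /iid_expect mulr_sumr; apply: eq_bigr => x _; rewrite mulrCA. Qed.

(** The pairing with [color_step X] is a sum of one term per vertex, so the expectation is a product
    over the cells. Each factor is at most the cell average of [\sum_r p r * expR (lam r)], which is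
    the constant 1. *)
Lemma chernoff n lam : (0 < n)%N -> tilting p lam ->
  iid_expect p (fun X : n.-tuple 'I_c => expR (n%:R * pairing lam (color_step X))) <= 1.
Proof.
move=> n0 [ilam iexp lam1].
have nR : 0 < n%:R :> R by rewrite ltr0n.
under eq_fun do rewrite pairing_color_step// mulr_sumr expR_sum.
rewrite /iid_expect (product_weight_prod (fun _ r => p ord0 r)
  (fun i r => expR (n%:R * cell_int (lam r) i))).
rewrite -[leRHS](_ : \prod_(i < n) 1 = 1); last by rewrite big1.
apply: ler_prod => i _; apply/andP; split.
  by apply: sumr_ge0 => r _; rewrite mulr_ge0 ?expR_ge0// ltW.
apply: (@le_trans _ _ (\sum_(r < c) n%:R * cell_int (fun u => p ord0 r * (expR \o lam r) u) i)).
  apply: ler_sum => r _; rewrite cell_intZ// mulrCA.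
  by apply: ler_wpM2l; [exact/ltW|exact: cell_int_expR].
rewrite -mulr_sumr -cell_int_sumr//; last by move=> r; exact: EFin_integrableZ.
rewrite -[leRHS](@divff _ n%:R) ?gt_eqF// ler_pM2l// -[leRHS]div1r -(cell_int_cst n0 1 i).
apply: le_cell_int => //.
- by apply: EFin_integrable_sum => // r _; exact: EFin_integrableZ.
- exact: integrable_cst_EFin.
- by move=> u uI; rewrite lam1.
Qed.

(** A tilting whose pairing with [f] exceeds [b] still exceeds [b] near [f], and it bounds the
    relative entropy from below. *)
Lemma relative_entropy_lsc f b : color_fun f -> b < relative_entropy p f ->
  weak_nbhs f [set g | b < relative_entropy p g].
Proof.
move=> fc bf FF fFF cFF wFF.
have [lam tlam lamf] := tilting_exists p_gt0 p_sum fc (e := (relative_entropy p f - b) / 2)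
  ltac:(lra).
have [ilam _ _] := tlam.
have H : \forall g \near FF, b < pairing lam g.
  by apply: cvgr_gt (pairing_cvg ilam wFF) _ _; lra.
by apply: filterS2 H cFF => g /= bg gc; apply: lt_le_trans bg _; exact: pairing_le.
Qed.

Section upper_bound.
Variables (Psi : forall n, n.-tuple 'I_c -> R) (Phi : colors -> R).
Variables (E : forall n, set (n.-tuple 'I_c)) (M : R).
Hypothesis Phi_cvg : forall FF f, Filter FF -> FF (@color_fun R c) -> color_fun f ->
  weak_cvg FF f -> Phi @ FF --> Phi f.
Hypothesis Psi_le : forall d, 0 < d -> \forall n \near \oo,
  forall X : n.-tuple 'I_c, E X -> Psi X <= Phi (color_step X) + d.
(** Near [f] the moment has an exponential rate of at most about [Phi f - relative_entropy p f], and
    it vanishes if [E] avoids a neighborhood of [f]. Either alternative keeps the contribution of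
    [f] below [M]. *)
Hypothesis bound : forall f, color_fun f -> Phi f - relative_entropy p f < M \/
  exists2 P, weak_nbhs f P & \forall n \near \oo,
    forall X : n.-tuple 'I_c, P (color_step X) -> ~ E X.

Definition exp_moment n (F : n.-tuple 'I_c -> R) (B : set (n.-tuple 'I_c)) : R :=
  iid_expect p (fun X => expR (n%:R * F X) * \1_B X).

Lemma le_exp_moment n (F : n.-tuple 'I_c -> R) (B B' : set (n.-tuple 'I_c)) :
  B `<=` B' -> exp_moment F B <= exp_moment F B'.
Proof.
move=> BB'; apply: iid_expect_le => X; apply: ler_wpM2l; first exact: expR_ge0.
rewrite !indicE; have [|] := boolP (X \in B); last by rewrite ler0n.
by rewrite inE => /BB' XB'; rewrite mem_set.
Qed.

Lemma exp_moment_set0 n (F : n.-tuple 'I_c -> R) : exp_moment F set0 = 0.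
Proof. by rewrite /exp_moment /iid_expect big1// => X _; rewrite indic0 !mulr0. Qed.

Lemma exp_momentU n (F : n.-tuple 'I_c -> R) (B B' : set (n.-tuple 'I_c)) :
  exp_moment F (B `|` B') <= exp_moment F B + exp_moment F B'.
Proof.
rewrite /exp_moment -iid_expectD; apply: iid_expect_le => X; rewrite -mulrDr.
apply: ler_wpM2l; first exact: expR_ge0.
rewrite !indicE in_setU; case: (X \in B); case: (X \in B') => /=; lra.
Qed.

(** A strict gap between exponents absorbs constant factors, such as the 2 of a union bound. *)
Lemma near_expR_nat (a b k : R) : a < b ->
  \forall n \near \oo, k * expR (n%:R * a) <= expR (n%:R * b).
Proof.
move=> ab; have [k0|k0] := leP k 0.
  apply: nearW => n; apply: le_trans (expR_ge0 _).
  by rewrite mulr_le0_ge0// expR_ge0.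
near=> n; rewrite -{1}(lnK k0) -expRD ler_expR -lerBrDr -mulrBr.
rewrite -ler_pdivrMr ?subr_gt0//; near: n; exact: nbhs_infty_ger.
Unshelve. all: by end_near. Qed.

Let negligible (V : set colors) := exists2 a, a < M & \forall n \near \oo,
  exp_moment (@Psi n) (@E n `&` [set X | V (color_step X)]) <= expR (n%:R * a).

Let negligibleU V V' : negligible V -> negligible V' -> negligible (V `|` V').
Proof.
move=> [a aM Va] [a' aM' Va']; pose m := Num.max a a'.
have mM : m < M by rewrite gt_max aM.
exists ((m + M) / 2); first by lra.
have := near_expR_nat 2 (_ : m < (m + M) / 2) => /(_ ltac:(lra)) H.
near=> n; apply: (@le_trans _ _ (2 * expR (n%:R * m))); last by near: n.
apply: (@le_trans _ _ (exp_moment (@Psi n) (@E n `&` [set X | V (color_step X)]) +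
    exp_moment (@Psi n) (@E n `&` [set X | V' (color_step X)]))).
  rewrite (_ : _ `&` _ = (@E n `&` [set X | V (color_step X)]) `|`
    (@E n `&` [set X | V' (color_step X)])); first exact: exp_momentU.
  by rewrite -setIUr.
rewrite mulr2n mulrDl mul1r; apply: lerD.
  apply: (@le_trans _ _ (expR (n%:R * a))); first by near: n.
  by rewrite ler_expR ler_wpM2l// le_max lexx.
apply: (@le_trans _ _ (expR (n%:R * a'))); first by near: n.
by rewrite ler_expR ler_wpM2l// le_max lexx orbT.
Unshelve. all: by end_near. Qed.

Let negligible_sub V V' : V `<=` V' -> negligible V' -> negligible V.
Proof.
move=> VV' [a aM Va]; exists a => //; apply: filterS Va => n; apply: le_trans.
by apply: le_exp_moment => X [EX VX]; split=> //; exact: VV'.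
Qed.

Let negligible_eventually V :
  (\forall n \near \oo, forall X : n.-tuple 'I_c, V (color_step X) -> ~ E X) ->
  negligible V.
Proof.
move=> VE; exists (M - 1); first by lra.
apply: filterS VE => n VE; rewrite (_ : _ `&` _ = set0).
  by rewrite exp_moment_set0 expR_ge0.
by apply/seteqP; split=> // X [EX /VE].
Qed.

(* The sets of color functions outside of which the moment is exponentially smaller
   than [M] form a filter.  Were it proper, the weak limit of a finer ultrafilter would
   contradict [bound]. *)
Lemma exp_moment_upper_bound : exists2 a, a < M &
  \forall n \near \oo, exp_moment (@Psi n) (@E n) <= expR (n%:R * a).
Proof.
apply: contrapT => nconcl; pose FF : set_system colors := [set V | negligible (~` V)].
have nT : ~ negligible setT.
  move=> [a aM Ha]; apply: nconcl; exists a => //; apply: filterS Ha => n.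
  by rewrite (_ : _ `&` _ = @E n)//; apply/seteqP; split=> [X []|X].
have fFF : Filter FF.
  split.
  - by apply: negligible_sub (negligible_eventually (V := set0) _);
      rewrite ?setCT//; exact: nearW.
  - by move=> V V' nV nV'; rewrite /FF /= setCI; exact: negligibleU.
  - by move=> V V' VV'; apply: negligible_sub; exact: subsetC.
have pFF : ProperFilter FF.
  by split=> //; rewrite /FF /= setC0.
have cFF : FF (@color_fun R c).
  apply: negligible_eventually; near=> n => X /= nc _; apply: nc.
  by apply: color_fun_step; near: n; exact: nbhs_infty_gt.
have [U [UU FU]] := ultraFilterLemma pFF.
have Uc := FU _ cFF.
have [f fc fU] := weak_compact Uc.
have contra V : negligible V -> ~ U V.
  move=> nV UV; have : U (~` V) by apply: FU; rewrite /FF /= setCK.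
  by move=> /(filterI UV); rewrite setICr; exact: filter_not_empty.
have [JM|[P fP PE]] := bound fc; last first.
  by apply: (contra P); [exact: negligible_eventually|exact: fP].
set J := Phi f - relative_entropy p f in JM.
(* The losses add up to [4 * d]: one [d] for the tilting, one for the variation of the pairing near
   [f], one for that of [Phi], and one for replacing [Psi] by [Phi]. The fifth makes the final
   inequality strict. *)
pose d := (M - J) / 5; have d0 : 0 < d by rewrite /d; lra.
have [lam tlam lamf] := tilting_exists p_gt0 p_sum fc d0; have [ilam _ _] := tlam.
pose V := [set g | relative_entropy p f - 2 * d < pairing lam g /\ Phi g < Phi f + d].
apply: (contra V); last first.
  apply: filterI.
    by apply: cvgr_gt (pairing_cvg ilam fU) _ _; lra.
  by apply: cvgr_lt (Phi_cvg _ Uc fc fU) _ _; lra.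
exists (J + 4 * d); first by rewrite /d; lra.
have := Psi_le d0; near_simpl => Psid; near=> n.
have n0 : (0 < n)%N by near: n; exact: nbhs_infty_gt.
have Psin : forall X : n.-tuple 'I_c, E X -> Psi X <= Phi (color_step X) + d by near: n.
rewrite -[leRHS]mulr1; apply: (@le_trans _ _ (expR (n%:R * (J + 4 * d)) *
  iid_expect p (fun X : n.-tuple 'I_c => expR (n%:R * pairing lam (color_step X))))); last first.
  by apply: ler_wpM2l; [exact: expR_ge0|exact: chernoff].
rewrite -iid_expectZ; apply: iid_expect_le => X; rewrite indicE.
have [|_] := boolP (X \in _); last by rewrite mulr0 mulr_ge0 ?expR_ge0.
rewrite inE => -[EX [V1 V2]]; rewrite mulr1 -expRD ler_expR -mulrDr ler_wpM2l//.
by have := Psin _ EX; rewrite /J; lra.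
Unshelve. all: by end_near. Qed.

End upper_bound.

End asymptotics.

(** * Exponential lower bounds *)

Section cell_averages.
Context (R : realType) (n : nat).
Hypothesis n_gt0 : (0 < n)%N.
Local Notation mu := (@lebesgue_measure R).
Local Notation I01 := (`[0, 1]%classic : set (measurableTypeR R)).
Local Notation intg f := (mu.-integrable I01 (EFin \o f)).
Let mI : measurable I01. Proof. exact: measurable_itv. Qed.
Let Ioo := @unit_interval_finite R.
Let nR : 0 < n%:R :> R. Proof. by rewrite ltr0n. Qed.
Implicit Types (w phi : R -> R).

Lemma eq_cell_int phi w (i : 'I_n) : {in cell i, phi =1 w} -> cell_int phi i = cell_int w i.
Proof.
move=> pw; apply: eq_Rintegral => u _; rewrite indicE.
by case: (boolP (u \in cell i)) => [/pw ->//|_]; rewrite !mulr0.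
Qed.

Lemma cell_bounds (i : 'I_n) (u : R) : cell i u -> i%:R <= n%:R * u <= i.+1%:R.
Proof.
rewrite (cellE R n_gt0) /= in_itv/= => /andP[/lteifW lo hi].
by move: lo hi; rewrite ler_pdivrMr// ler_pdivlMr// (mulrC u) => -> ->.
Qed.

(* Averaging [w] over the cells changes its integral against the indicator of a
   half-line by at most [1 / n]: a single cell meets both the half-line and its
   complement. *)
Lemma cell_average_halfline w (a : R) : weight I01 w ->
  `|\sum_(i < n) cell_int \1_(`]a, +oo[%classic : set R) i * (n%:R * cell_int w i) -
    \int[mu]_(u in I01) (\1_(`]a, +oo[%classic : set R) u * w u)| <= n%:R^-1.
Proof.
set phi : R -> R := \1_(_); move=> ww.
have wphi : weight I01 phi by apply: weight_indic; exact: measurable_itv.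
have iw := weight_integrable mI Ioo ww; have iphi := weight_integrable mI Ioo wphi.
have wpw : weight I01 (fun u => phi u * w u).
  split; first by apply: measurable_funM; [exact: wphi.1|exact: ww.1].
  move=> u uI; have /andP[p0 p1] := wphi.2 u uI; have /andP[w0 w1] := ww.2 u uI.
  by rewrite mulr_ge0// mulr_ile1.
have ipw := weight_integrable mI Ioo wpw.
rewrite -(cell_int_sum n_gt0 ipw) -sumrB.
apply: le_trans (ler_norm_sum _ _ _) _.
(* The only index whose cell may be cut by the threshold [a]: before it [phi] is 0, after it [phi]
   is 1. A negative [a] is truncated to 0, which is harmless because the error on one cell is at
   most [n%:R^-1] in any case. *)
pose k := Num.truncn (n%:R * a).
have cst k0 (i : 'I_n) : {in cell i, phi =1 fun=> k0} ->
    cell_int phi i * (n%:R * cell_int w i) - cell_int (fun u => phi u * w u) i = 0.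
  move=> phik; rewrite (eq_cell_int phik) (cell_int_cst n_gt0).
  rewrite (@eq_cell_int (fun u => phi u * w u) (fun u => k0 * w u)) ?(cell_intZ n_gt0)//.
    by rewrite mulrA divfK ?subrr// gt_eqF.
  by move=> u ui; rewrite phik.
have phiE u : phi u = (a < u)%R%:R.
  rewrite /phi indicE; congr (nat_of_bool _)%:R; apply/idP/idP.
    by rewrite inE /= in_itv/= andbT.
  by move=> au; rewrite inE /= in_itv/= andbT.
apply: (@le_trans _ _ (\sum_(i < n) if i == k :> nat then n%:R^-1 else 0)).
  apply: ler_sum => i _; case: ifPn => [_|].
    have /andP[a0 a1] := cell_int_weight n_gt0 i wphi.
    have /andP[b0 b1] := cell_int_weight n_gt0 i ww.
    have /andP[c0 c1] := cell_int_weight n_gt0 i wpw.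
    have h0 : 0 <= n%:R * cell_int w i by rewrite mulr_ge0.
    have h1 : n%:R * cell_int w i <= 1 by rewrite -ler_pdivlMl// mulr1.
    have h2 : 0 <= cell_int phi i * (n%:R * cell_int w i) by rewrite mulr_ge0.
    have h3 : cell_int phi i * (n%:R * cell_int w i) <= n%:R^-1.
      by apply: le_trans a1; rewrite ler_piMr.
    by rewrite ler_norml; apply/andP; split; lra.
  rewrite neq_ltn => /orP[ik|ki].
    rewrite (cst 0) ?normr0// => u /set_mem/cell_bounds/andP[_ ui].
    rewrite phiE; case: ltP => // au.
    have : n%:R * a < i.+1%:R by apply: lt_le_trans ui; rewrite ltr_pM2l.
    have a0 : 0 <= n%:R * a.
      rewrite leNgt; apply/negP => na0.
      have k0 : (k <= 0)%N by rewrite truncn_le_nat (lt_trans na0).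
      by have := leq_trans ik k0.
    by rewrite -truncn_lt_nat// ltnS leqNgt ik.
  rewrite (cst 1) ?normr0// => u /set_mem/cell_bounds/andP[ui _].
  rewrite phiE; case: ltP => // ua.
  have := lt_le_trans (truncnS_gt (n%:R * a)) (_ : k.+1%:R <= i%:R) => /(_ _)/[!ler_nat].
  move=> /(_ ki) nai; have := le_trans ui (_ : n%:R * u <= n%:R * a).
  by rewrite ler_pM2l// => /(_ ua); rewrite leNgt nai.
rewrite -big_mkcond/=; have [kn|nk] := ltnP k n.
  rewrite (bigD1 (Ordinal kn))//= big1 ?addr0// => i /andP[/eqP ik /eqP].
  by case; apply: val_inj.
rewrite big1 ?invr_ge0// => i /eqP ik; have := ltn_ord i.
by rewrite ik ltnNge nk.
Qed.

End cell_averages.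

Section lower_bound.
Context (R : realType) (c : nat).
Local Notation mu := (@lebesgue_measure R).
Local Notation I01 := (`[0, 1]%classic : set (measurableTypeR R)).
Local Notation intg f := (mu.-integrable I01 (EFin \o f)).
Local Notation colors := (R -> 'rV[R]_c).
Let mI : measurable I01. Proof. exact: measurable_itv. Qed.
Let Ioo := @unit_interval_finite R.
Implicit Types (P : set colors).

Variable f : colors.
Hypothesis fc : color_fun f.

Definition tilted n (i : 'I_n) (r : 'I_c) : R := n%:R * cell_int (fun u => f u ord0 r) i.

Let fw r : weight I01 (fun u => f u ord0 r). Proof. exact: color_fun_weight. Qed.
Let fI r : intg (fun u => f u ord0 r). Proof. exact: weight_integrable. Qed.

Lemma tilted_ge0 n (n0 : (0 < n)%N) (i : 'I_n) r : 0 <= tilted i r.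
Proof. by rewrite mulr_ge0//; case/andP: (cell_int_weight n0 i (fw r)). Qed.

Lemma tilted_sum n (n0 : (0 < n)%N) (i : 'I_n) : \sum_(r < c) tilted i r = 1.
Proof.
rewrite -mulr_sumr -cell_int_sumr// (@eq_cell_int _ _ _ (fun=> 1)).
  by rewrite cell_int_cst// div1r divff// pnatr_eq0 -lt0n.
move=> u /set_mem/cell_sub; have [_ _] := fc; exact.
Qed.

Let weight_tilted_ge0 n (n0 : (0 < n)%N) (X : n.-tuple 'I_c) :
  0 <= product_weight (@tilted n) X.
Proof. by apply: prodr_ge0 => i _; exact: tilted_ge0. Qed.

Definition tilted_prob n (V : set colors) : R :=
  \sum_(X : n.-tuple 'I_c) product_weight (@tilted n) X * \1_V (color_step X).

Lemma tilted_prob_le n V V' : (0 < n)%N -> V `<=` V' -> tilted_prob n V <= tilted_prob n V'.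
Proof.
move=> n0 VV'; apply: ler_sum => X _; apply: ler_wpM2l; first exact: weight_tilted_ge0.
rewrite !indicE; have [|] := boolP (_ \in V); last by rewrite ler0n.
by rewrite inE => /VV' XV'; rewrite mem_set.
Qed.

Definition unlikely V := forall e, 0 < e -> \forall n \near \oo, tilted_prob n V <= e.

(** Convergence along this filter is convergence in probability under the tilted laws, so the filter
    statements [weighted_cvg] and [weak_nbhs] apply to random colorings as they are. *)
Let likely : set_system colors := [set V | unlikely (~` V)].

Let likely_filter : Filter likely.
Proof.
split.
- move=> e e0; rewrite setCT; apply: nearW => n; rewrite /tilted_prob.
  by rewrite big1 ?ltW// => X _; rewrite indic0 mulr0.
- move=> V V' LV LV' e e0; rewrite setCI.
  have e20 : 0 < e / 2 by lra.
  have h := LV _ e20; have h' := LV' _ e20; near=> n.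
  have n0 : (0 < n)%N by near: n; exact: nbhs_infty_gt.
  apply: (@le_trans _ _ (tilted_prob n (~` V) + tilted_prob n (~` V'))).
    rewrite /tilted_prob -big_split /=; apply: ler_sum => X _; rewrite -mulrDr.
    apply: ler_wpM2l; first exact: weight_tilted_ge0.
    rewrite !indicE in_setU; case: (_ \in ~` V); case: (_ \in ~` V') => /=; lra.
  have h1 : tilted_prob n (~` V) <= e / 2 by near: n.
  have h2 : tilted_prob n (~` V') <= e / 2 by near: n.
  by lra.
- move=> V V' VV' LV e e0; have := LV e e0; near_simpl => h; near=> n.
  have n0 : (0 < n)%N by near: n; exact: nbhs_infty_gt.
  apply: (@le_trans _ _ (tilted_prob n (~` V))); last by near: n.
  by apply: tilted_prob_le => //; exact: subsetC.
Unshelve. all: by end_near. Qed.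

Let likely_color : likely (@color_fun R c).
Proof.
move=> e e0; near=> n.
have n0 : (0 < n)%N by near: n; exact: nbhs_infty_gt.
rewrite /tilted_prob big1 ?ltW// => X _; rewrite indicE memNset ?mulr0//.
by apply; exact: color_fun_step.
Unshelve. all: by end_near. Qed.

(** Bias and fluctuation. Averaging over the cells moves the integral by at most [n%:R^-1 <= e / 2],
    so an error above [e] forces a centered sum [D X] of size at least [e / 2]. Its variance is at
    most [n * n^-2], and Chebyshev's inequality gives the factor [4 / e ^+ 2]. *)
Let likely_halfline r (a : R) :
  (fun g : colors => \int[mu]_(u in I01)
     (\1_(`]a, +oo[%classic : set R) u * g u ord0 r)) @ likely -->
  \int[mu]_(u in I01) (\1_(`]a, +oo[%classic : set R) u * f u ord0 r).
Proof.
set phi : R -> R := \1_(_); have LF := likely_filter.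
apply/cvgrPdist_le => e e0 d d0.
have wphi : weight I01 phi by apply: weight_indic; exact: measurable_itv.
have iphi := weight_integrable mI Ioo wphi.
have h : 0 < e / 2 by lra.
near=> n; have n0 : (0 < n)%N by near: n; exact: nbhs_infty_gt.
have nR : 0 < n%:R :> R by rewrite ltr0n.
have ne : n%:R^-1 <= e / 2.
  rewrite invf_ple ?posrE//; near: n; exact: nbhs_infty_ger.
have nd : 4 / (e ^+ 2) * n%:R^-1 <= d.
  rewrite ler_pdivrMr// -ler_pdivrMl//; near: n; exact: nbhs_infty_ger.
have avg := cell_average_halfline n0 a (fw r).
pose D (X : n.-tuple 'I_c) := \sum_(i < n) cell_int phi i * ((tnth X i == r)%:R - tilted i r).
apply: (@le_trans _ _ (\sum_(X : n.-tuple 'I_c)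
    product_weight (@tilted n) X * (4 / e ^+ 2 * D X ^+ 2))).
  apply: ler_sum => X _; apply: ler_wpM2l; first exact: weight_tilted_ge0.
  have c0 : 0 <= 4 / e ^+ 2 by rewrite divr_ge0// exprn_ge0// ltW.
  rewrite indicE; case: (boolP (_ \in _)) => [|_]; last by rewrite mulr_ge0// sqr_ge0.
  rewrite inE /= => /negP; rewrite -ltNge Rintegral_color_step// => De.
  have eD : e / 2 <= `|D X|.
    have -> : D X = - ((\int[mu]_(u in I01) (phi u * f u ord0 r)
        - \sum_(i < n) (tnth X i == r)%:R * cell_int phi i)
        + (\sum_(i < n) cell_int phi i * (n%:R * cell_int (fun u => f u ord0 r) i)
        - \int[mu]_(u in I01) (phi u * f u ord0 r))).
      rewrite /D; under eq_bigr do rewrite mulrBr mulrC.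
      by rewrite sumrB /tilted; lra.
    rewrite normrN; have := lerB_normD
      (\int[mu]_(u in I01) (phi u * f u ord0 r)
        - \sum_(i < n) (tnth X i == r)%:R * cell_int phi i)
      (\sum_(i < n) cell_int phi i * (n%:R * cell_int (fun u => f u ord0 r) i)
        - \int[mu]_(u in I01) (phi u * f u ord0 r)).
    by lra.
  have : (e / 2) ^+ 2 <= D X ^+ 2.
    by rewrite -(real_normK (num_real (D X))) ler_pXn2r ?nnegrE// ltW.
  move=> /(ler_wpM2l c0); apply: le_trans.
  by rewrite le_eqVlt; apply/orP; left; apply/eqP; field; rewrite gt_eqF.
under eq_bigr do rewrite mulrCA; rewrite -mulr_sumr.
apply: le_trans nd; apply: ler_wpM2l.
  by rewrite divr_ge0// exprn_ge0// ltW.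
apply: le_trans (product_weight_variance (tilted_ge0 n0) (tilted_sum n0) _ _) _.
apply: (@le_trans _ _ (\sum_(i < n) n%:R^-1 ^+ 2)).
  apply: ler_sum => i _; have /andP[a0 a1] := cell_int_weight n0 i wphi.
  by rewrite ler_pXn2r ?nnegrE// invr_ge0 ltW.
by rewrite sumr_const card_ord -[leLHS]mulr_natl expr2 mulrA divff ?mul1r// gt_eqF.
Unshelve. all: by end_near. Qed.

Lemma tilted_weak_cvg : weak_cvg likely f.
Proof.
move=> r phi iphi; have LF := likely_filter.
apply: (weighted_cvg (FF := LF) mI Ioo (w := fun (g : colors) u => g u ord0 r) _ (fw r)
  (P := @RGenOInfty.G R) _ _ _ _ iphi).
- have lc : \forall g \near likely, color_fun g by exact: likely_color.
  by near=> g; apply: color_fun_weight; near: g.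
- exact: RGenOInfty.measurableE.
- move=> _ _ [a ->] [b ->]; exists (Num.max a b); apply/seteqP; split=> x /=.
    by rewrite !in_itv/= !andbT gt_max => -[-> ->].
  by rewrite !in_itv/= !andbT gt_max => /andP[].
(* The half-line from -1 contains the unit interval and gives the convergence of the total
   integrals. *)
- have := @likely_halfline r (-1).
  have one u : I01 u -> \1_(`](-1), +oo[%classic : set R) u = 1 :> R.
    move=> /=; rewrite in_itv/= => /andP[u0 _]; rewrite indicE mem_set//=.
    by rewrite in_itv/= andbT (lt_le_trans _ u0)// oppr_lt0.
  have E (g : colors) : \int[mu]_(u in I01)
      (\1_(`](-1), +oo[%classic : set R) u * g u ord0 r) = \int[mu]_(u in I01) g u ord0 r.
    by apply: eq_Rintegral => u /set_mem uI; rewrite one// mul1r.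
  by rewrite E; under eq_fun do rewrite E.
- by move=> _ [a ->]; exact: likely_halfline.
Unshelve. all: by end_near. Qed.

Lemma tilted_unlikely P : weak_nbhs f P -> unlikely (~` P).
Proof.
have LF := likely_filter; move=> /(_ likely LF likely_color) H.
exact/H/tilted_weak_cvg.
Qed.

Variable p : 'rV[R]_c.
Hypotheses (p_gt0 : forall r, 0 < p ord0 r) (p_sum : \sum_(r < c) p ord0 r = 1).

Definition log_likelihood n (X : n.-tuple 'I_c) : R :=
  \sum_(i < n) (ln (tilted i (tnth X i)) - ln (p ord0 (tnth X i))).

Lemma tilted_entropy_le n (n0 : (0 < n)%N) :
  \sum_(X : n.-tuple 'I_c) product_weight (@tilted n) X * log_likelihood X
  <= n%:R * relative_entropy p f.
Proof.
have xI r : intg (fun u => f u ord0 r * ln (f u ord0 r)) by apply: integrable_xlnx.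
have yI r : intg (fun u => ln (p ord0 r) * f u ord0 r) by apply: EFin_integrableZ.
under eq_bigr do rewrite mulr_sumr.
rewrite exchange_big /=.
under eq_bigr do rewrite (product_weight_marginal (tilted_sum n0) _
  (fun r => ln (tilted _ r) - ln (p ord0 r))).
rewrite relative_entropyE// Rintegral_sum//; last first.
  by move=> r _; exact: EFin_integrableB.
rewrite mulr_sumr [leRHS](eq_bigr (fun r => \sum_(i < n) (n%:R *
    cell_int (fun u => f u ord0 r * ln (f u ord0 r)) i - ln (p ord0 r) * tilted i r))).
  rewrite [leRHS]exchange_big; apply: ler_sum => i _; apply: ler_sum => r _.
  rewrite mulrBr; apply: lerB; last by rewrite mulrC.
  exact: cell_int_xlnx.
move=> r _; rewrite RintegralB// mulrBr -(cell_int_sum n0 (xI r)) -(cell_int_sum n0 (yI r)).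
rewrite sumrB !mulr_sumr; congr (_ - _); apply: eq_bigr => i _.
by rewrite cell_intZ// /tilted mulrCA.
Qed.

Lemma iid_lower_bound P d : weak_nbhs f P -> 0 < d ->
  \forall n \near \oo, expR (- (n%:R * (relative_entropy p f + d))) <=
    iid_prob p [set X : n.-tuple 'I_c | P (color_step X)].
Proof.
move=> /tilted_unlikely Pf d0; set I := relative_entropy p f.
have I0 : 0 <= I by exact: relative_entropy_ge0.
(* The change of measure yields [b * expR (- (n%:R * I + 1) / b)] with [b >= 1 - e], whence
   [b^-1 <= 1 + 2 * e] as [e <= 1 / 2]. The second bound on [e] keeps the loss [2 * e * n%:R * I]
   below [n%:R * d / 2], and [8 <= n%:R * d] covers the bounded terms. The [+ 1] allows for
   [I = 0]. *)
pose e := Num.min (1 / 2) (d / (4 * (I + 1))).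
have e0 : 0 < e by rewrite lt_min !divr_gt0// mulr_gt0//; lra.
have eI : 4 * e * I <= d.
  have : e <= d / (4 * (I + 1)) by rewrite ge_min lexx orbT.
  by rewrite ler_pdivlMr ?mulr_gt0//; nra.
have e2 : e <= 1 / 2 by rewrite ge_min lexx.
have Pe := Pf e e0; near=> n.
have n0 : (0 < n)%N by near: n; exact: nbhs_infty_gt.
have nR : 0 < n%:R :> R by rewrite ltr0n.
have nd : 8 <= n%:R * d by rewrite -ler_pdivrMr//; near: n; exact: nbhs_infty_ger.
have be : tilted_prob n (~` P) <= e by near: n.
pose E (X : n.-tuple 'I_c) := color_step X \in P.
pose b := \sum_(X | E X) product_weight (@tilted n) X.
have bE : 1 - e <= b.
  have : b + tilted_prob n (~` P) = 1.
    rewrite -(product_weight_sum1 (tilted_sum n0)) [RHS](bigID E)/=; congr (_ + _).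
    rewrite /tilted_prob [RHS]big_mkcond/=; apply: eq_bigr => X _.
    by rewrite indicE in_setC /E; case: (_ \in P); rewrite ?mulr0 ?mulr1.
  by lra.
have b0 : 0 < b by lra.
have pw x : 0 < product_weight (fun (_ : 'I_n) r => p ord0 r) x.
  by apply: prodr_gt0 => i _.
have := change_of_measure pw (product_weight_sum1 (fun=> p_sum))
  (weight_tilted_ge0 n0) (L := @log_likelihood n) _ (tilted_entropy_le n0) erefl b0.
have -> : \sum_(x | E x) product_weight (fun (_ : 'I_n) r => p ord0 r) x =
    iid_prob p [set X : n.-tuple 'I_c | P (color_step X)].
  rewrite big_mkcond; apply: eq_bigr => X _; rewrite indicE /E.
  rewrite (_ : (X \in _) = (color_step X \in P)); last by apply/idP/idP; rewrite !inE.
  by case: ifP; rewrite ?mulr1 ?mulr0.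
move=> /(_ _) H; apply: le_trans (H _); last first.
  move=> X; rewrite /product_weight /log_likelihood => qX.
  have q0 i : 0 < tilted i (tnth X i).
    rewrite lt_neqAle tilted_ge0// andbT eq_sym; apply: contraTneq qX => qi0.
    by rewrite (bigD1 i)//= qi0 mul0r ltxx.
  rewrite expR_sum -big_split; apply: eq_bigr => i _ /=.
  by rewrite expRB !lnK ?posrE// mulrC divfK// gt_eqF.
have b1 : expR (- 1) <= b.
  apply: (@le_trans _ _ (1 / 2)); last by lra.
  rewrite expRN div1r lef_pV2 ?posrE ?expR_gt0//.
  by have := expR_ge1Dx (1 : R); lra.
apply: (@le_trans _ _ (expR (- 1) * expR (- (n%:R * I + 1) / b))); last first.
  by apply: ler_wpM2r => //; exact: expR_ge0.
rewrite -expRD ler_expR.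
have bi : b^-1 <= 1 + 2 * e.
  rewrite -div1r ler_pdivrMr//.
  have : 0 <= (b - (1 - e)) * (1 + 2 * e) by apply: mulr_ge0; lra.
  have : 0 <= e * (1 - 2 * e) by apply: mulr_ge0; lra.
  by lra.
have nI : 0 <= n%:R * I + 1 by rewrite addr_ge0// mulr_ge0.
have := ler_wpM2l nI bi; rewrite mulNr.
have : n%:R * (4 * e * I) <= n%:R * d by rewrite ler_wpM2l.
by rewrite !mulrDr !mulrDl; lra.
Unshelve. all: by end_near. Qed.

End lower_bound.

(** * Large deviations of the color counts *)

Section step_kernels.
Context (R : realType) (v c n : nat).
Hypothesis n_gt0 : (0 < n)%N.
Local Notation mu := (@lebesgue_measure R).
Local Notation nu := (@lebesgue_power R v).
Local Notation I01 := (`[0, 1]%classic : set (measurableTypeR R)).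
Local Notation cube := (@cube R v).
Local Notation intg f := (nu.-integrable cube (EFin \o f)).
Variables (Q : tensor R v n) (W : v.-tuple (measurableTypeR R) -> R).
Hypothesis iW : intg W.

Let mcube : measurable cube. Proof. exact: measurable_cube. Qed.
Let cubeoo := @cube_finite R v.

Let cells (i : v.-tuple 'I_n) : set (v.-tuple (measurableTypeR R)) :=
  box (fun a => cell (tnth i a)).

Let mcells i : measurable (cells i).
Proof. by apply: measurable_box => a; exact: measurable_cell. Qed.

Let cells_sub i : cells i `<=` cube.
Proof. by move=> x xi a; exact: cell_sub (xi a). Qed.

Let cells_inj i j x : cells i x -> cells j x -> i = j.
Proof. by move=> ix jx; apply: eq_from_tnth => a; exact: cell_inj (ix a) (jx a). Qed.

Let cells_cover x : cube x -> exists i, cells i x.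
Proof.
move=> xc; have ex a : exists i : 'I_n, cell i (tnth x a).
  by apply: cell_cover => //; exact: xc.
have [i ix] := choice ex.
by exists [tuple i a | a < v] => a; rewrite tnth_mktuple.
Qed.

Lemma step_kernel_cell i x : cells i x -> step_kernel Q x = Q i.
Proof.
move=> ix; rewrite /step_kernel; case: pickP => [j /forallP jx|/(_ i)/forallP nx].
  congr Q; apply: (@cells_inj _ _ x) => // a; split; last exact/eqP/jx.
  by have [] := ix a.
by exfalso; apply: nx => a; apply/eqP; have [] := ix a.
Qed.

Lemma step_kernel_sum x : cube x -> step_kernel Q x = \sum_i Q i * \1_(cells i) x.
Proof.
move=> /cells_cover[i ix]; rewrite (step_kernel_cell ix).
rewrite (bigD1 i)//= indicE mem_set// mulr1 big1 ?addr0// => j ji.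
by rewrite indicE memNset ?mulr0// => /(cells_inj ix) ij; rewrite ij eqxx in ji.
Qed.

Let indic_intg i : intg (\1_(cells i) : _ -> R).
Proof. by apply: weight_integrable => //; exact: weight_indic. Qed.

Lemma step_kernel_integrable : intg (step_kernel Q).
Proof.
have : intg (fun x => \sum_i Q i * \1_(cells i) x).
  by apply: EFin_integrable_sum => // i _; exact: EFin_integrableZ.
by apply: eq_integrable => // x /set_mem xc /=; rewrite step_kernel_sum.
Qed.

Let prod_weight (X : n.-tuple 'I_c) r :
  weight cube (fun x => \prod_(a < v) color_step (R := R) X (tnth x a) ord0 r).
Proof.
apply: (weight_prod (D := I01) (w := fun _ u => color_step X u ord0 r)) => // a.
exact/color_fun_weight/color_fun_step.
Qed.

Lemma lebesgue_cells i : nu (cells i) = ((n%:R^-1) ^+ v)%:E.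
Proof.
rewrite /cells /lebesgue_power power_measure_box; last by move=> a; exact: measurable_cell.
under eq_bigr do rewrite /= (lebesgue_cell R n_gt0).
by rewrite prodEFin prodr_const card_ord.
Qed.

Lemma kernel_functional_step (X : n.-tuple 'I_c) :
  kernel_functional (step_kernel Q) (color_step X) = color_counts Q X.
Proof.
apply/rowP => r; rewrite !mxE.
transitivity (\int[nu]_(x in cube) \sum_(i : v.-tuple 'I_n)
    Q i * [forall a, tnth X (tnth i a) == r]%:R * \1_(cells i) x).
  apply: eq_Rintegral => x /set_mem xc; have [j jx] := cells_cover xc.
  rewrite (step_kernel_cell jx) (bigD1 j)//= indicE mem_set// mulr1.
  rewrite [X in _ = _ + X]big1 ?addr0 => [|i ij]; last first.
    by rewrite indicE memNset ?mulr0// => /(cells_inj jx) ji; rewrite ji eqxx in ij.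
  congr (_ * _); under eq_bigr do rewrite (color_step_cell _ _ (jx _)).
  have [/forallP rj|/forallPn[a /negPf ra]] := boolP [forall a, tnth X (tnth j a) == r].
    by rewrite big1// => a _; rewrite rj.
  by rewrite (bigD1 a)//= ra mul0r.
rewrite Rintegral_sum//; last by move=> i _; exact: EFin_integrableZ.
rewrite mulr_sumr [RHS]big_mkcond; apply: eq_bigr => i _.
rewrite RintegralZl//.
have -> : \int[nu]_(x in cube) \1_(cells i) x = n%:R ^- v.
  rewrite /Rintegral integral_indic// (setIidl (@cells_sub i)) -exprVn.
  exact: (congr1 fine (lebesgue_cells i)).
by case: ifP => _; rewrite ?mulr1 ?mulr0 ?mul0r// mulrC.
Qed.

Lemma color_counts_close (X : n.-tuple 'I_c) r :
  (`|color_counts Q X ord0 r - kernel_functional W (color_step X) ord0 r|%:E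
   <= cut_norm (fun x => step_kernel Q x - W x)%R)%E.
Proof.
pose S : set R := [set x | I01 x /\ color_step X x ord0 r = 1].
have SE : S = \bigcup_(i in [set i : 'I_n | tnth X i = r]) cell i.
  apply/seteqP; split=> x.
    move=> [xI]; have [i ix] := cell_cover n_gt0 xI; rewrite (color_step_cell _ _ ix).
    by case: eqP => [Xi _|_ /eqP]; [exists i|rewrite eq_sym oner_eq0].
  move=> [i Xi ix]; split; first exact: cell_sub ix.
  by rewrite (color_step_cell _ _ ix) Xi eqxx.
have mS : measurable S.
  rewrite SE; apply: fin_bigcup_measurable; first exact: finite_finset.
  by move=> i _; exact: measurable_cell.
have SI : S `<=` `[0, 1]%classic by move=> x [].
have iD : intg (fun x => step_kernel Q x - W x).
  by apply: EFin_integrableB => //; exact: step_kernel_integrable.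
have mSv : measurable (@cartesian_power R v S) by exact: (@measurable_box _ _ v (fun=> S)).
have -> : color_counts Q X ord0 r - kernel_functional W (color_step X) ord0 r =
    \int[nu]_(x in cartesian_power S) (step_kernel Q x - W x).
  rewrite -kernel_functional_step !mxE -RintegralB//; last 2 first.
  - by apply: integrableM_weight => //; exact: step_kernel_integrable.
  - exact: integrableM_weight.
  rewrite (_ : cartesian_power S = cube `&` cartesian_power S); last first.
    by apply/esym/setIidr => x xS a; exact: (SI _ (xS a)).
  rewrite Rintegral_mkcondr; apply: eq_Rintegral => x /set_mem xc.
  rewrite -mulrBl patchE; case: ifPn => [/set_mem xS|/negP xS].
    by rewrite big1 ?mulr1// => a _; have [] := xS a.
  have [a Xa] : exists a, ~ S (tnth x a).
    by apply: contrapT => /forallNP H; apply/xS/mem_set => a; apply: contrapT; exact: H.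
  rewrite (bigD1 a)//=; have [i ix] := cell_cover n_gt0 (xc a).
  move: Xa; rewrite (color_step_cell _ _ ix) /S /= (color_step_cell _ _ ix).
  case: eqP => [_ H|_ _]; last by rewrite mul0r mulr0.
  by exfalso; apply: H; split=> //; exact: xc.
rewrite EFin_normr_Rintegral//; last first.
  by apply: integrableS iD => // x xS a; exact: (SI _ (xS a)).
by apply: ereal_sup_ubound; exists S.
Qed.

End step_kernels.

(** * Exponential bounds for the energy of a coloring *)

Section gibbs_asymptotics.
Context (R : realType) (c v : nat).
Local Notation mu := (@lebesgue_measure R).
Local Notation I01 := (`[0, 1]%classic : set (measurableTypeR R)).
Local Notation colors := (R -> 'rV[R]_c).
Variables (Q : forall n, tensor R v n) (W : v.-tuple (measurableTypeR R) -> R).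
Hypothesis iW : (@lebesgue_power R v).-integrable (@cube R v) (EFin \o W).
Hypothesis Qcvg : cut_norm (fun x => step_kernel (@Q n) x - W x)
  @[n --> \oo] --> (0 : \bar R)%E.
Variables (p alpha : 'rV[R]_c).
Hypotheses (p_gt0 : forall r, 0 < p ord0 r) (p_sum : \sum_(r < c) p ord0 r = 1).
Implicit Types (f g : colors).

Local Notation I := (relative_entropy p).
Definition energy f : R := dot alpha (kernel_functional W f).
Definition tensor_energy n (X : n.-tuple 'I_c) : R := dot alpha (color_counts (@Q n) X).

Lemma energy_cvg FF f : Filter FF -> FF (@color_fun R c) -> color_fun f ->
  weak_cvg FF f -> energy @ FF --> energy f.
Proof.
move=> fFF cFF fc wFF; rewrite /energy /dot.
apply: cvg_big => [|r _]; first exact: add_continuous.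
apply: cvgMl_tmp; exact: kernel_functional_cvg.
Qed.

Lemma tensor_energy_close d : 0 < d -> \forall n \near \oo,
  forall X : n.-tuple 'I_c, `|tensor_energy X - energy (color_step X)| <= d.
Proof.
(* The tolerance is divided by [A + 1] and not by [A], as [alpha] may be 0. *)
move=> d0; pose A := \sum_(r < c) `|alpha ord0 r|.
have A0 : 0 <= A by apply: sumr_ge0.
have d'0 : 0 < d / (A + 1) by rewrite divr_gt0//; lra.
have /fine_cvgP[Qfin /cvgrPdist_le/(_ _ d'0) Qd] : cut_norm (fun x => step_kernel (@Q n) x - W x)
  @[n --> \oo] --> (0%:E : \bar R)%E by exact: Qcvg.
near=> n => X.
have n0 : (0 < n)%N by near: n; exact: nbhs_infty_gt.
have Kfin : cut_norm (fun x => step_kernel (@Q n) x - W x) \is a fin_num by near: n.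
have Kd : `|0 - fine (cut_norm (fun x => step_kernel (@Q n) x - W x))| <= d / (A + 1).
  by near: n.
rewrite /tensor_energy /energy /dot -sumrB; apply: le_trans (ler_norm_sum _ _ _) _.
apply: (@le_trans _ _ (\sum_(r < c) `|alpha ord0 r| * (d / (A + 1)))).
  apply: ler_sum => r _; rewrite -mulrBr normrM; apply: ler_wpM2l => //.
  apply: le_trans Kd; rewrite sub0r normrN; apply: le_trans (ler_norm _).
  rewrite -lee_fin fineK//; exact: color_counts_close.
rewrite -mulr_suml -/A mulrA ler_pdivrMr; last by lra.
by rewrite mulrC ler_wpM2l//; lra.
Unshelve. all: by end_near. Qed.

Lemma energy_nbhs f (e : R) : color_fun f -> 0 < e ->
  weak_nbhs f [set g | `|energy g - energy f| < e].
Proof.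
move=> fc e0 FF fFF cFF wFF; move/cvgrPdist_lt: (energy_cvg fFF cFF fc wFF) => /(_ e e0).
by apply: filterS => g /=; rewrite distrC.
Qed.

Lemma le_iid_prob n (B B' : set (n.-tuple 'I_c)) : B `<=` B' ->
  iid_prob p B <= iid_prob p B'.
Proof.
move=> BB'; apply: iid_expect_le => // X.
rewrite !indicE; have [|] := boolP (X \in B); last by rewrite ler0n.
by rewrite inE => /BB' XB'; rewrite mem_set.
Qed.

(** The moment bound with exponent 0. If the energy of [f] lies outside the closed set [F], so do
    eventually the energies of all colorings near [f], which is the second alternative of
    [bound]. *)
Lemma prob_upper_bound (F : set R) (M : R) : closed F ->
  (forall f, color_fun f -> F (energy f) -> - I f < M) ->
  exists2 a, a < M & \forall n \near \oo,
    iid_prob p [set X : n.-tuple 'I_c | F (tensor_energy X)] <= expR (n%:R * a).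
Proof.
move=> cF FM.
have := @exp_moment_upper_bound R c p p_gt0 p_sum (fun n _ => 0) (fun=> 0)
  (fun n => [set X : n.-tuple 'I_c | F (tensor_energy X)]) M.
case.
- by move=> *; exact: cvg_cst.
- by move=> d d0; apply: nearW => n X _; rewrite add0r ltW.
- move=> f fc; have [Ff|nFf] := pselect (F (energy f)).
    by left; rewrite sub0r; exact: FM.
  right; have : nbhs (energy f) (~` F) by apply: open_nbhs_nbhs; split=> //; exact: closed_openC.
  move=> /nbhs_ballP[e /= e0 eF]; exists [set g | `|energy g - energy f| < e / 2].
    by apply: energy_nbhs => //; lra.
  have h : 0 < e / 2 by lra.
  have := tensor_energy_close h; apply: filterS => n close X /= Xe; apply: eF => /=.
  rewrite /ball/= distrC; have := close X.
  by have := ler_distD (energy (color_step X)) (tensor_energy X) (energy f); lra.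
- move=> a aM H; exists a => //; apply: filterS H => n; apply: le_trans.
  rewrite /exp_moment /iid_prob; apply: iid_expect_le => // X.
  by rewrite mulr0 expR0 mul1r.
Qed.

Lemma prob_lower_bound (G : set R) f d : open G -> color_fun f -> G (energy f) ->
  0 < d -> \forall n \near \oo, expR (- (n%:R * (I f + d))) <=
    iid_prob p [set X : n.-tuple 'I_c | G (tensor_energy X)].
Proof.
move=> oG fc Gf d0.
have : nbhs (energy f) G by apply: open_nbhs_nbhs; split.
move=> /nbhs_ballP[e /= e0 eG]; have h : 0 < e / 2 by lra.
have close := tensor_energy_close h.
have := iid_lower_bound fc p_gt0 p_sum (energy_nbhs fc h) d0.
apply: filterS2 close => n close; move/le_trans; apply; apply: le_iid_prob => X /= Xe.
apply: eG => /=; rewrite /ball/= distrC; have := close X.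
by have := ler_distD (energy (color_step X)) (tensor_energy X) (energy f); lra.
Qed.

Lemma moment_upper_bound (E : forall n, set (n.-tuple 'I_c)) (M : R) :
  (forall f, color_fun f -> energy f - I f < M \/
    exists2 P, weak_nbhs f P & \forall n \near \oo,
      forall X : n.-tuple 'I_c, P (color_step X) -> ~ E n X) ->
  exists2 a, a < M & \forall n \near \oo,
    exp_moment p (@tensor_energy n) (E n) <= expR (n%:R * a).
Proof.
move=> H; apply: (exp_moment_upper_bound p_gt0 p_sum energy_cvg _ H) => d d0.
apply: filterS (tensor_energy_close d0) => n close X _.
by have := ler_norm (tensor_energy X - energy (color_step X)); have := close X; lra.
Qed.

(** Keep only the colorings with energy within [d / 2] of that of [f]; the other half of [d] pays
    for their probability. *)
Lemma moment_lower_bound f d : color_fun f -> 0 < d -> \forall n \near \oo,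
  expR (n%:R * (energy f - I f - d)) <= exp_moment p (@tensor_energy n) setT.
Proof.
move=> fc d0; have h : 0 < d / 2 by lra.
have := @prob_lower_bound (ball (energy f) (d / 2)) f (d / 2) (ball_open _ _) fc
  (ballxx _ h) h.
apply: filterS => n lo.
have -> : n%:R * (energy f - I f - d) =
  n%:R * (energy f - d / 2) + - (n%:R * (I f + d / 2)) by lra.
rewrite expRD; apply: (@le_trans _ _ (expR (n%:R * (energy f - d / 2)) *
  iid_prob p [set X : n.-tuple 'I_c | ball (energy f) (d / 2) (tensor_energy X)])).
  by apply: ler_wpM2l => //; exact: expR_ge0.
rewrite -iid_expectZ; apply: iid_expect_le => // X.
rewrite indicT mulr1 indicE; have [|_] := boolP (X \in _); last by rewrite mulr0 expR_ge0.
rewrite inE mulr1 => eX; rewrite ler_expR ler_wpM2l//.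
have : `|energy f - tensor_energy X| < d / 2 by exact: eX.
by have := ler_norm (energy f - tensor_energy X); lra.
Qed.

(** An upper semicontinuous function on a compact space has a maximum. Without one, the strict
    superlevel sets would generate a proper filter; the weak limit of a finer ultrafilter is at
    least as good as every color function, and yet one would be better. *)
Lemma energy_argmax : exists2 f, color_fun f &
  forall g, color_fun g -> energy g - I g <= energy f - I f.
Proof.
have [[f0 f0c]|nc] := pselect (exists f : colors, color_fun f); last first.
  have [r0] : exists r0 : 'I_c, True.
    apply: contrapT => /forallNP nr; have := oner_neq0 R.
    by rewrite -p_sum big1 ?eqxx// => r _; have := nr r.
  move=> _; exfalso; apply: nc; exists (fun=> p); split=> [r|x _ r|x _ //].
    exact: measurable_cst.
  rewrite ltW//= -p_sum (bigD1 r)//= lerDl; apply: sumr_ge0 => s _; exact: ltW.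
apply: contrapT => nmax.
have better f : color_fun f -> exists2 g, color_fun g & energy f - I f < energy g - I g.
  move=> fc; apply: contrapT => ng; apply: nmax; exists f => // g gc.
  by rewrite leNgt; apply/negP => fg; apply: ng; exists g.
pose FF : set_system colors := [set V | exists2 g0, color_fun g0 &
  forall g, color_fun g -> energy g0 - I g0 < energy g - I g -> V g].
have fFF : Filter FF.
  split.
  - by exists f0.
  - move=> V V' [g gc gV] [g' gc' gV'].
    have [le|/ltW le] := leP (energy g - I g) (energy g' - I g').
      by exists g' => // k kc kg; split; [exact/gV/(le_lt_trans le)|exact: gV'].
    by exists g => // k kc kg; split; [exact: gV|exact/gV'/(le_lt_trans le)].
  - by move=> V V' VV' [g gc gV]; exists g => // k kc kg; exact/VV'/gV.
have pFF : ProperFilter FF.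
  split=> // -[g gc gV]; have [k kc gk] := better g gc; exact: (gV k).
have [U [UU FU]] := ultraFilterLemma pFF.
have Uc : U (@color_fun R c) by apply: FU; exists f0.
have [f fc fU] := weak_compact Uc.
have [g gc fg] := better f fc.
(* Near [f] the energy gains less than [d] and the relative entropy loses less than [d], in total
   less than the gap [3 * d] up to [g]. *)
pose d := (energy g - I g - (energy f - I f)) / 3; have d0 : 0 < d by rewrite /d; lra.
have h1 : U [set k | energy g - I g < energy k - I k] by apply: FU; exists g.
have h2 : U [set k | `|energy k - energy f| < d] by exact: energy_nbhs.
have h3 : U [set k | I f - d < I k] by apply: relative_entropy_lsc fU => //; lra.
have [k [k1 [k2 k3]]] := filter_ex (filterI h1 (filterI h2 h3)).
move: k1 k3 k2 => /= k1 k3; rewrite ltr_norml => /andP[_]; rewrite /d in k3 *; lra.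
Qed.

End gibbs_asymptotics.

(** * Extended-real inequalities through real bounds *)

Section extended_reals.
Context (R : realType).

(** Infima of the rate function may be infinite; comparing with real numbers reduces the large
    deviation bounds to real exponents. *)
Lemma lee_of_EFin (y z : \bar R) :
  (forall x : R, (y < x%:E)%E -> (z <= x%:E)%E) -> (z <= y)%E.
Proof.
move=> H; rewrite leNgt; apply/negP; case: y z H => [y||] [z||] H //.
- rewrite lte_fin => yz; have := H ((y + z) / 2); rewrite lte_fin lee_fin => /(_ ltac:(lra)); lra.
- by move=> _; have := H (y + 1); rewrite lte_fin ltrDl ltr01 leye_eq => /(_ isT).
- by move=> _; have := H (z - 1) (ltNyr _); rewrite lee_fin; lra.
- by move=> _; have := H 0 (ltNyr _); rewrite leye_eq.
Qed.

Lemma EFin_lee (y z : \bar R) :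
  (forall x : R, (x%:E < y)%E -> (x%:E <= z)%E) -> (y <= z)%E.
Proof.
move=> H; rewrite -leeN2; apply: lee_of_EFin => x xy.
by rewrite leeNl -EFinN; apply: H; rewrite EFinN lteNl.
Qed.

Lemma limn_esup_le (u : nat -> \bar R) x :
  (\forall n \near \oo, (u n <= x)%E) -> (limn_esup u <= x)%E.
Proof.
move=> H; rewrite /limn_esup limf_esupE; apply: ge_ereal_inf.
exists (ereal_sup (u @` [set n | (u n <= x)%E])); first by exists [set n | (u n <= x)%E].
by apply: ge_ereal_sup => _ [n un <-].
Qed.

Lemma le_limn_einf (u : nat -> \bar R) x :
  (\forall n \near \oo, (x <= u n)%E) -> (x <= limn_einf u)%E.
Proof.
move=> H; rewrite -leeN2 -limn_esupN; apply: limn_esup_le.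
by apply: filterS H => n /=; rewrite leeN2.
Qed.

End extended_reals.

Section softmax_entropy.
Context (R : realType) (c : nat).
Local Notation mu := (@lebesgue_measure R).
Local Notation I01 := (`[0, 1]%classic : set (measurableTypeR R)).
Variable h : 'rV[R]_c.
Hypothesis c_gt0 : (0 < c)%N.

Let S := \sum_(s < c) expR (h ord0 s).

Lemma partition_gt0 : 0 < S.
Proof.
rewrite /S (bigD1 (Ordinal c_gt0))//= ltr_pwDl ?expR_gt0//.
by apply: sumr_ge0 => s _; exact: expR_ge0.
Qed.

Lemma softmax_gt0 r : 0 < softmax h ord0 r.
Proof. by rewrite mxE divr_gt0 ?expR_gt0//; exact: partition_gt0. Qed.

Lemma softmax_sum : \sum_(r < c) softmax h ord0 r = 1.
Proof.
under eq_bigr do rewrite mxE; rewrite -mulr_suml divff// gt_eqF//.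
exact: partition_gt0.
Qed.

Lemma mean_sum (f : R -> 'rV[R]_c) : color_fun f -> \sum_(r < c) mean f ord0 r = 1.
Proof.
move=> fc; under eq_bigr do rewrite mxE.
have mI : measurable I01 by exact: measurable_itv.
rewrite -Rintegral_sum//; last first.
  move=> r _; apply: weight_integrable => //; first exact: unit_interval_finite.
  exact: color_fun_weight.
transitivity (\int[mu]_(u in I01) 1).
  by apply: eq_Rintegral => u /set_mem uI; have [_ _] := fc; apply.
rewrite Rintegral_cst// mul1r.
by rewrite /= lebesgue_measure_itv/= lte_fin ltr01 oppr0 adde0.
Qed.

(** The logarithm of [softmax h] at [r] is [h r - ln S], and the means add up to 1. *)
Lemma relative_entropy_softmax f : color_fun f ->
  relative_entropy (softmax h) f = entropy f - dot h (mean f) + ln S.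
Proof.
move=> fc; rewrite /relative_entropy -addrA; congr (_ + _).
have -> : \sum_(r < c) ln (softmax h ord0 r) * mean f ord0 r =
    dot h (mean f) - ln S * \sum_(r < c) mean f ord0 r.
  rewrite /dot mulr_sumr -sumrB; apply: eq_bigr => r _; rewrite -mulrBl; congr (_ * _).
  by rewrite mxE ln_div ?posrE ?expR_gt0 ?expRK//; exact: partition_gt0.
by rewrite mean_sum// mulr1 opprB addrC.
Qed.

End softmax_entropy.

(** * Rate function, free energy and Gibbs measure *)

Section rate_function.
Context (R : realType) (c v : nat).
Local Notation colors := (R -> 'rV[R]_c).
Variables (W : v.-tuple (measurableTypeR R) -> R) (alpha h : 'rV[R]_c).
Hypothesis iW : (@lebesgue_power R v).-integrable (@cube R v) (EFin \o W).
Hypothesis c_gt0 : (0 < c)%N.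
Local Notation I := (relative_entropy (softmax h)).
Local Notation Phi := (energy W alpha).
Let p_gt0 := softmax_gt0 h c_gt0.
Let p_sum := softmax_sum h c_gt0.

(** The constant enters the infimum, also when no color function has energy [t] and both sides are
    [+oo]. *)
Lemma rateE t : rate W alpha h t =
  ereal_inf [set (I f)%:E | f in [set f | color_fun f /\ Phi f = t]].
Proof.
rewrite /rate; set A := [set f | _]; set s := ln _.
have AE f : A f -> (I f)%:E = ((entropy f - dot h (mean f))%:E + s%:E)%E.
  by move=> [fc _]; rewrite relative_entropy_softmax.
apply/eqP; rewrite eq_le; apply/andP; split.
  apply: le_ereal_inf_tmp => _ [f Af <-]; rewrite AE// leeD2r//.
  by apply: ereal_inf_lbound; exists f.
rewrite -leeBlDr//; apply: le_ereal_inf_tmp => _ [f Af <-].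
rewrite leeBlDr// -AE//; apply: ereal_inf_lbound; by exists f.
Qed.

Lemma rate_le f : color_fun f -> (rate W alpha h (Phi f) <= (I f)%:E)%E.
Proof. by move=> fc; rewrite rateE; apply: ereal_inf_lbound; exists f. Qed.

Lemma rate_lt_ex t (x : R) : (rate W alpha h t < x%:E)%E ->
  exists f, [/\ color_fun f, Phi f = t & I f < x].
Proof.
by rewrite rateE => /ereal_inf_lt[_ [f [fc ft] <-]]; rewrite lte_fin; exists f.
Qed.

Lemma rate_ge0 t : (0 <= rate W alpha h t)%E.
Proof.
rewrite rateE; apply: le_ereal_inf_tmp => _ [f [fc _] <-].
by rewrite lee_fin; exact: relative_entropy_ge0.
Qed.

(** If the rate fell to [a] arbitrarily close to [t], color functions of relative entropy below [a']
    would have energies tending to [t]. A weak limit has energy [t] by continuity and relative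
    entropy at most [a'] by semicontinuity, although [a'] is below the rate at [t]. *)
Lemma rate_lsc : lower_semicontinuous (rate W alpha h).
Proof.
move=> t a aI; apply: contrapT => nV.
(* The room between [a] and [a'] supplies near-minimizers, so no infimum has to be attained. *)
have [a' [aa' a'I]] : exists a' : R, a < a' /\ (a'%:E < rate W alpha h t)%E.
  move: aI; case: (rate W alpha h t) => [x| |//]; last first.
    by exists (a + 1); rewrite ltry; split=> //; lra.
  by rewrite lte_fin => ax; exists ((a + x) / 2); rewrite lte_fin; split; lra.
have ex V : nbhs t V -> exists f, [/\ color_fun f, V (Phi f) & I f < a'].
  move=> tV; apply: contrapT => nf; apply: nV; exists V => // y Vy.
  rewrite ltNge; apply/negP => ya.
  have [f [fc fy If]] := rate_lt_ex (le_lt_trans ya (aa' : (a%:E < a'%:E)%E)).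
  by apply: nf; exists f; rewrite fy.
pose FF : set_system colors := [set P | exists2 V, nbhs t V &
  forall f, color_fun f -> V (Phi f) -> I f < a' -> P f].
have fFF : Filter FF.
  split.
  - by exists setT => //; exact: filterT.
  - move=> P P' [V tV VP] [V' tV' VP']; exists (V `&` V'); first exact: filterI.
    by move=> f fc [Vf V'f] fa; split; [exact: VP|exact: VP'].
  - by move=> P P' PP' [V tV VP]; exists V => // f fc Vf fa; exact/PP'/VP.
have pFF : ProperFilter FF.
  by split=> // -[V tV VP]; have [f [fc Vf If]] := ex V tV; exact: (VP f).
have [U [UU FU]] := ultraFilterLemma pFF.
have Uc : U (@color_fun R c) by apply: FU; exists setT => //; exact: filterT.
have [f fc fU] := weak_compact Uc.
have ft : Phi f = t.
  apply: (@cvg_unique _ (@Rhausdorff R) (Phi @ U)).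
    exact: energy_cvg.
  by move=> V tV; apply: FU; exists V.
have If : I f <= a'.
  rewrite leNgt; apply/negP => a'f.
  have h1 : U [set g | a' < I g] by apply: relative_entropy_lsc fU.
  have h2 : U [set g | I g < a'] by apply: FU; exists setT => //; exact: filterT.
  have [g [/= g1 g2]] := filter_ex (filterI h1 h2).
  by have := lt_trans g1 g2; rewrite ltxx.
have := rate_le fc; rewrite ft => /(lt_le_trans a'I).
by rewrite lte_fin ltNge If.
Qed.

Lemma energy_bounded : exists K, forall f, color_fun f -> `|Phi f| <= K.
Proof.
exists (\sum_(r < c) `|alpha ord0 r| *
  \int[@lebesgue_power R v]_(x in @cube R v) `|W x|) => f fc.
rewrite /energy /dot; apply: le_trans (ler_norm_sum _ _ _) _; apply: ler_sum => r _.
rewrite normrM; apply: ler_wpM2l => //; rewrite mxE.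
have mcube := @measurable_cube R v.
have i0 : (@lebesgue_power R v).-integrable (@cube R v) (EFin \o fun=> 0).
  exact: integrable_cst_EFin (@cube_finite R v).
have wf : weight (@cube R v) (fun x => \prod_(a < v) f (tnth x a) ord0 r).
  apply: (weight_prod (D := `[0, 1]%classic : set (measurableTypeR R))
    (w := fun _ u => f u ord0 r)) => // a.
  exact: color_fun_weight.
have := Rintegral_weight_close mcube iW i0 wf.
under [X in _ - X]eq_Rintegral do rewrite mul0r.
rewrite Rintegral_cst// mul0r subr0 => /le_trans; apply.
by under eq_Rintegral do rewrite subr0.
Qed.

(** A sublevel set is closed by semicontinuity and bounded because a finite rate makes [t] an
    energy, and energies are bounded. *)
Lemma rate_good : good_rate_function (rate W alpha h).
Proof.
split; [exact: rate_ge0|exact: rate_lsc|move=> a].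
have [K PhiK] := energy_bounded.
apply: (@subclosed_compact _ _ `[(- K)%R, K]); last 1 first.
- move=> t /= ta; have := le_lt_trans ta (_ : (a%:E < (a + 1)%:E)%E).
  rewrite lte_fin ltrDl => /(_ ltr01)/rate_lt_ex[f [fc <- _]].
  by rewrite in_itv/= -ler_norml; exact: PhiK.
- rewrite (_ : [set t | _] = ~` [set t | (a%:E < rate W alpha h t)%E]); last first.
    apply/seteqP; split=> t /=; first by move=> ta; apply/negP; rewrite -leNgt.
    by move=> /negP; rewrite -leNgt.
  by apply: open_closedC; have /lower_semicontinuousP := rate_lsc; apply.
- exact: segment_compact.
Qed.

End rate_function.

Section main_results.
Context (R : realType) (c v : nat).
Local Notation colors := (R -> 'rV[R]_c).
Variables (Q : forall n, tensor R v n) (W : v.-tuple (measurableTypeR R) -> R).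
Hypothesis iW : (@lebesgue_power R v).-integrable (@cube R v) (EFin \o W).
Hypothesis Qcvg : cut_norm (fun x => step_kernel (@Q n) x - W x)
  @[n --> \oo] --> (0 : \bar R)%E.
Variables (alpha h : 'rV[R]_c).
Hypothesis c_gt0 : (0 < c)%N.
Local Notation p := (softmax h).
Local Notation I := (relative_entropy p).
Local Notation Phi := (energy W alpha).
Local Notation psi := (@tensor_energy R c v Q alpha _).
Local Notation S := (\sum_(s < c) expR (h ord0 s)).
Let p_gt0 := softmax_gt0 h c_gt0.
Let p_sum := softmax_sum h c_gt0.

Lemma LDP_energy : satisfies_LDP
  (fun n (B : set R) => (iid_prob p
     [set X : n.-tuple 'I_c | B (dot alpha (color_counts (@Q n) X))])%:E)
  (fun n => n%:R) (rate W alpha h).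
Proof.
split=> [F cF|G oG].
- apply: lee_of_EFin => x xF.
  have ub f : color_fun f -> F (Phi f) -> - I f < x.
    move=> fc Ff; have : (ereal_inf (rate W alpha h @` F) <= (I f)%:E)%E.
      apply: (@le_trans _ _ (rate W alpha h (Phi f))); last exact: rate_le.
      by apply: ereal_inf_lbound; exists (Phi f).
    rewrite -leeN2 => /le_lt_trans/(_ xF).
    by rewrite -EFinN lte_fin.
  have [a ax H] := prob_upper_bound iW Qcvg p_gt0 p_sum cF ub.
  apply: limn_esup_le; near=> n.
  have n0 : (0 < n)%N by near: n; exact: nbhs_infty_gt.
  have nR : 0 < n%:R :> R by rewrite ltr0n.
  have Pn : iid_prob p [set X : n.-tuple 'I_c | F (dot alpha (color_counts (@Q n) X))]
    <= expR (n%:R * a) by near: n.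
  apply: (@le_trans _ _ a%:E); last by rewrite lee_fin ltW.
  rewrite lee_pdivrMl// -EFinM -[leRHS](@expeRK R).
  have [P0|P0] := leP (iid_prob p
      [set X : n.-tuple 'I_c | F (dot alpha (color_counts (@Q n) X))]) 0.
    by rewrite le0_lneNy ?leNye// lee_fin.
  by rewrite lee_lne/= ?lee_fin// in_itv/= leey lee_fin ltW// expR_gt0.
- apply: EFin_lee => x; rewrite lteNr => /ereal_inf_lt[_ [t Gt <-]].
  rewrite -EFinN => /(rate_lt_ex c_gt0)[f [fc ft fx]].
  have d0 : 0 < - x - I f by lra.
  have H := prob_lower_bound iW Qcvg p_gt0 p_sum oG fc (_ : G (Phi f)) d0.
  apply: le_limn_einf; near=> n.
  have n0 : (0 < n)%N by near: n; exact: nbhs_infty_gt.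
  have nR : 0 < n%:R :> R by rewrite ltr0n.
  have Pn : expR (- (n%:R * (I f + (- x - I f)))) <=
      iid_prob p [set X : n.-tuple 'I_c | G (dot alpha (color_counts (@Q n) X))].
    by near: n; apply: H; rewrite ft.
  rewrite lee_pdivlMl// -EFinM -[leLHS](@expeRK R).
  have P0 := lt_le_trans (expR_gt0 _) Pn.
  rewrite lee_lne/= ?lee_fin ?in_itv/= ?leey ?lee_fin ?(ltW P0) ?expR_ge0//.
  by apply: le_trans Pn; rewrite ler_expR; lra.
Unshelve. all: by end_near. Qed.

(* [exp (sum_i h (X_i)) = (sum_s exp (h s)) ^ n * prod_i p (X_i)] absorbs the
   external field into the product law. *)
Lemma uniform_hamiltonian n (F : n.-tuple 'I_c -> R) :
  iid_expect (uniform_law R c)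
    (fun X => expR (hamiltonian (@Q n) alpha h X) * F X) =
  (S / c%:R) ^+ n * iid_expect p (fun X => expR (n%:R * psi X) * F X).
Proof.
have S0 : 0 < S by exact: partition_gt0.
rewrite /iid_expect mulr_sumr; apply: eq_bigr => X _.
have -> : \prod_(i < n) uniform_law R c ord0 (tnth X i) = c%:R^-1 ^+ n.
  by under eq_bigr do rewrite mxE; rewrite prodr_const card_ord.
have -> : \prod_(i < n) p ord0 (tnth X i) =
    expR (\sum_(i < n) h ord0 (tnth X i)) / S ^+ n.
  under eq_bigr do rewrite mxE; rewrite big_split/= expR_sum; congr (_ * _).
  by rewrite prodr_const card_ord exprVn.
have -> : hamiltonian (@Q n) alpha h X = n%:R * psi X + \sum_(i < n) h ord0 (tnth X i).
  congr (_ + _); apply: eq_bigr => i _; rewrite (bigD1 (tnth X i))//= eqxx mulr1.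
  by rewrite big1 ?addr0// => a /negPf; rewrite eq_sym => ->; rewrite mulr0.
have Sn0 : S ^+ n != 0 by rewrite expf_neq0// gt_eqF.
rewrite expRD exprMn; move: (S ^+ n) (_^-1 ^+ n) Sn0 => s k s0.
by field.
Qed.

Local Notation Z n := (exp_moment p (@tensor_energy R c v Q alpha n) setT).

Lemma log_partitionE n : (0 < n)%N -> 0 < Z n ->
  log_partition (@Q n) alpha h = ln S - ln c%:R + n%:R^-1 * ln (Z n).
Proof.
move=> n0 Z0; have S0 : 0 < S by exact: partition_gt0.
have cR : 0 < c%:R :> R by rewrite ltr0n.
rewrite /log_partition.
have -> : iid_expect (uniform_law R c) (fun X => expR (hamiltonian (@Q n) alpha h X)) =
    (S / c%:R) ^+ n * Z n.
  have -> : Z n = iid_expect p (fun X : n.-tuple 'I_c => expR (n%:R * psi X) * 1).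
    by rewrite /exp_moment indicT.
  rewrite -uniform_hamiltonian; congr iid_expect; apply/funext => X.
  by rewrite mulr1.
rewrite lnM ?posrE ?exprn_gt0 ?divr_gt0// lnXn ?divr_gt0// ln_div ?posrE//.
rewrite mulrDr; congr (_ + _); rewrite -[(_ - _) *+ n]mulr_natl mulrA mulVf ?mul1r//.
by rewrite gt_eqF// ltr0n.
Qed.

Lemma gibbsE n (E : set (n.-tuple 'I_c)) : (0 < n)%N -> 0 < Z n ->
  gibbs (@Q n) alpha h E = exp_moment p (@tensor_energy R c v Q alpha n) E / Z n.
Proof.
move=> n0 Z0; have S0 : 0 < S by exact: partition_gt0.
have cR : 0 < c%:R :> R by rewrite ltr0n.
have nR : 0 < n%:R :> R by rewrite ltr0n.
have -> : gibbs (@Q n) alpha h E = iid_expect (uniform_law R c)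
    (fun X => expR (hamiltonian (@Q n) alpha h X) *
      (expR (- (n%:R * log_partition (@Q n) alpha h)) * \1_E X)).
  by congr iid_expect; apply/funext => X; rewrite expRD mulrA.
rewrite uniform_hamiltonian log_partitionE//.
have -> : expR (- (n%:R * (ln S - ln c%:R + n%:R^-1 * ln (Z n)))) =
    ((S / c%:R) ^+ n)^-1 * (Z n)^-1.
  rewrite mulrDr mulrA divff ?gt_eqF// mul1r opprD expRD !expRN lnK ?posrE//.
  congr (_^-1 * _); rewrite -ln_div ?posrE// expRM_natl lnK//.
  by rewrite posrE divr_gt0.
under [X in _ * iid_expect _ X]eq_fun do rewrite mulrCA.
have k0 : (S / c%:R) ^+ n != 0 by rewrite expf_neq0// gt_eqF// divr_gt0.
by rewrite iid_expectZ !mulrA divff// mul1r mulrC.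
Qed.

Lemma free_energyE f : color_fun f -> free_energy W alpha h f = Phi f - I f + ln S.
Proof.
move=> fc; rewrite relative_entropy_softmax// /free_energy /energy; lra.
Qed.

Section maximum.
Variable f0 : colors.
Hypotheses (f0c : color_fun f0)
  (f0max : forall g, color_fun g -> Phi g - I g <= Phi f0 - I f0).

Lemma sup_free_energyE : sup_free_energy W alpha h = (free_energy W alpha h f0)%:E.
Proof.
apply/eqP; rewrite eq_le; apply/andP; split; last by apply: ereal_sup_ubound; exists f0.
apply: ge_ereal_sup => _ [g gc <-]; rewrite lee_fin !free_energyE//.
by rewrite lerD2r f0max.
Qed.

Lemma maximizersP g : maximizers W alpha h g <->
  color_fun g /\ Phi g - I g = Phi f0 - I f0.
Proof.
rewrite /maximizers /= sup_free_energyE; split=> -[gc].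
  by move=> [] /eqP; rewrite !free_energyE// (inj_eq (addIr _)) => /eqP.
by move=> e; split=> //; rewrite !free_energyE// e.
Qed.

Lemma moment_gt0 : \forall n \near \oo, 0 < Z n.
Proof.
have := moment_lower_bound iW Qcvg alpha p_gt0 p_sum f0c ltr01; apply: filterS => n.
exact/lt_le_trans/expR_gt0.
Qed.

(** From above, every [f] satisfies the first alternative of [bound] once [M] exceeds the maximum by
    [e]. From below, the maximizer [f0] alone is enough. *)
Lemma log_partition_cvg :
  (log_partition (@Q n) alpha h)%:E @[n --> \oo] -->
  (sup_free_energy W alpha h - (ln c%:R)%:E)%E.
Proof.
rewrite sup_free_energyE -EFinB free_energyE//; apply: cvg_EFin; first exact: nearW.
apply/cvgrPdist_le => e e0.
have [g gc|a ae Ha] := @moment_upper_bound R c v Q W iW Qcvg p alpha p_gt0 p_sum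
  (fun=> setT) (Phi f0 - I f0 + e).
  by left; apply: le_lt_trans (f0max gc) _; rewrite ltrDl.
have lo := moment_lower_bound iW Qcvg alpha p_gt0 p_sum f0c e0.
have Z0 := moment_gt0; near=> n.
have n0 : (0 < n)%N by near: n; exact: nbhs_infty_gt.
have nR : 0 < n%:R :> R by rewrite ltr0n.
have Zn : 0 < Z n by near: n.
have up_n : Z n <= expR (n%:R * a) by near: n.
have lo_n : expR (n%:R * (Phi f0 - I f0 - e)) <= Z n by near: n.
rewrite /= log_partitionE//.
have h1 : n%:R^-1 * ln (Z n) <= a.
  by rewrite ler_pdivrMl// -(expRK (n%:R * a)) ler_ln ?posrE ?expR_gt0.
have h2 : Phi f0 - I f0 - e <= n%:R^-1 * ln (Z n).
  by rewrite ler_pdivlMl// -[leLHS]expRK ler_ln ?posrE ?expR_gt0.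
by rewrite ler_norml; apply/andP; split; lra.
Unshelve. all: by end_near. Qed.

(** The numerator of the Gibbs probability grows with a rate [a] strictly below the maximum and the
    denominator with the maximum. Half of the gap, [d], is given up in the denominator, and the
    ratio still decays like [expR (- (n%:R * d))]. *)
Lemma gibbs_cvg0 (E : forall n, set (n.-tuple 'I_c)) :
  (forall f, color_fun f -> Phi f - I f < Phi f0 - I f0 \/
    exists2 P, weak_nbhs f P & \forall n \near \oo,
      forall X : n.-tuple 'I_c, P (color_step X) -> ~ E n X) ->
  gibbs (@Q n) alpha h (E n) @[n --> \oo] --> 0.
Proof.
move=> EP; have [a aM Ha] := moment_upper_bound iW Qcvg p_gt0 p_sum EP.
pose d := (Phi f0 - I f0 - a) / 2; have d0 : 0 < d by rewrite /d; lra.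
have lo := moment_lower_bound iW Qcvg alpha p_gt0 p_sum f0c d0.
have Z0 := moment_gt0; apply/cvgrPdist_le => e e0.
have := near_expR_nat e^-1 (_ : - d < 0) => /(_ ltac:(lra)) small0.
near=> n; have n0 : (0 < n)%N by near: n; exact: nbhs_infty_gt.
have Zn : 0 < Z n by near: n.
have up_n : exp_moment p (@tensor_energy R c v Q alpha n) (E n) <= expR (n%:R * a).
  by near: n.
have lo_n : expR (n%:R * (Phi f0 - I f0 - d)) <= Z n by near: n.
have small_n : e^-1 * expR (n%:R * - d) <= expR (n%:R * 0) by near: n.
rewrite gibbsE// sub0r normrN ger0_norm; last first.
  rewrite divr_ge0 ?(ltW Zn)// -(exp_moment_set0 p (@tensor_energy R c v Q alpha n)).
  exact: le_exp_moment.
rewrite ler_pdivrMr//; apply: le_trans up_n _.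
apply: (@le_trans _ _ (e * expR (n%:R * (Phi f0 - I f0 - d)))); last first.
  by rewrite ler_pM2l.
move: small_n; rewrite mulr0 expR0 ler_pdivrMl// mulr1 => small_n.
have -> : n%:R * a = n%:R * - d + n%:R * (Phi f0 - I f0 - d) by rewrite /d; lra.
by rewrite expRD ler_pM2r ?expR_gt0.
Unshelve. all: by end_near. Qed.

Lemma mean_nbhs (nrm : 'rV[R]_c -> R) f (e : R) : is_norm nrm -> color_fun f -> 0 < e ->
  weak_nbhs f [set g | nrm (mean g - mean f) < e].
Proof.
move=> [_ nZ nD] fc e0 FF fFF cFF wFF.
have n0 : nrm 0 = 0 by rewrite -(scale0r (0 : 'rV[R]_c)) nZ normr0 mul0r.
(* Any norm is dominated by a weighted sum of the coordinates, which reduces the claim to weak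
   convergence against the constant 1. *)
have nle x : nrm x <= \sum_(r < c) `|x ord0 r| * nrm (delta_mx ord0 r).
  rewrite {1}[x]row_sum_delta.
  elim/big_ind2 : _ => [|x1 x2 y1 y2 le1 le2|r _]; first by rewrite n0.
    exact: le_trans (nD _ _) (lerD le1 le2).
  by rewrite nZ.
have cv : (fun g : colors => \sum_(r < c) `|(mean g - mean f) ord0 r| * nrm (delta_mx ord0 r))
    @ FF --> (0 : R).
  rewrite [X in _ --> X](_ : 0 = \sum_(r < c) 0 * nrm (delta_mx ord0 r)); last first.
    by rewrite big1// => r _; rewrite mul0r.
  apply: cvg_big => [|r _]; first exact: add_continuous.
  apply: cvgMr_tmp; rewrite -(normr0 R); apply: cvg_norm.
  rewrite -(subrr (mean f ord0 r)).
  rewrite (_ : (fun g => _) = fun g : colors => mean g ord0 r - mean f ord0 r); last first.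
    by apply/funext => g; rewrite !mxE.
  apply: cvgB; last exact: cvg_cst.
  have i1 : (@lebesgue_measure R).-integrable `[0, 1] (EFin \o fun=> 1 : R).
    by apply: integrable_cst_EFin; [exact: measurable_itv|exact: unit_interval_finite].
  have mE (g : colors) : mean g ord0 r =
      \int[@lebesgue_measure R]_(u in `[0, 1]) (1 * g u ord0 r).
    by rewrite mxE; apply: eq_Rintegral => u _; rewrite mul1r.
  rewrite mE (funext mE); exact: wFF i1.
have : \forall g \near FF,
    \sum_(r < c) `|(mean g - mean f) ord0 r| * nrm (delta_mx ord0 r) < e.
  by apply: cvgr_lt cv _ e0.
by apply: filterS => g /=; exact: le_lt_trans.
Qed.

(** A color function that is not a maximizer falls under the first alternative. Near a maximizer [f]
    the proportions, being exactly the mean of [color_step X], are within [e] of [mean f], so the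
    bad event is void there. *)
Lemma gibbs_concentration (nrm : 'rV[R]_c -> R) (e : R) : is_norm nrm -> 0 < e ->
  gibbs (@Q n) alpha h
    [set X | (e%:E < dist nrm (proportions R X) (@mean R c @` maximizers W alpha h))%E]
  @[n --> \oo] --> (0 : R).
Proof.
move=> nnrm e0; apply: gibbs_cvg0 => f fc.
have := f0max fc; rewrite le_eqVlt => /predU1P[fmax|]; [right|by left].
exists [set g | nrm (mean g - mean f) < e]; first exact: mean_nbhs.
near=> n => X /=; rewrite mean_color_step => [ne|]; last by near: n; exact: nbhs_infty_gt.
apply/negP; rewrite -leNgt; apply: (@le_trans _ _ (nrm (proportions R X - mean f))%:E).
  apply: ereal_inf_lbound; exists (mean f) => //; exists f => //.
  exact/maximizersP.
by rewrite lee_fin ltW.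
Unshelve. all: by end_near. Qed.

End maximum.

End main_results.

Theorem proposition2p7 (R : realType) (c v : nat)
    (hc : (2 <= c)%N) (hv : (2 <= v)%N)
    (Q : forall n : nat, tensor R v n)
    (Qsym : forall n, (1 <= n)%N -> symmetric_tensor (Q n))
    (Qdiag : forall n, (1 <= n)%N -> zero_diagonal (Q n))
    (W : v.-tuple (measurableTypeR R) -> R) (hW : kernel_space W)
    (Qcvg : cut_norm (fun x => step_kernel (Q n) x - W x)
              @[n --> \oo] --> (0 : \bar R)%E)
    (h : 'rV[R]_c) :
  (forall alpha : 'rV[R]_c,
     good_rate_function (rate W alpha h) /\
     satisfies_LDP
       (fun n (B : set R) =>
          (iid_prob (softmax h)
             [set X : n.-tuple 'I_c | B (dot alpha (color_counts (Q n) X))])%:E)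
       (fun n => n%:R)
       (rate W alpha h)) /\
  (forall alpha : 'rV[R]_c,
     ((log_partition (Q n) alpha h)%:E @[n --> \oo]
        --> (sup_free_energy W alpha h - (ln c%:R)%:E)%E) /\
     (exists2 f : R -> 'rV[R]_c,
        color_fun f & (free_energy W alpha h f)%:E = sup_free_energy W alpha h)) /\
  (forall (alpha : 'rV[R]_c) (nrm : 'rV[R]_c -> R), is_norm nrm ->
     (forall eps : R, 0 < eps ->
        gibbs (Q n) alpha h
          [set X | (eps%:E < dist nrm (proportions R X)
                               (@mean R c @` maximizers W alpha h))%E]
          @[n --> \oo] --> (0 : R)) /\
     (forall fstar : R -> 'rV[R]_c,
        maximizers W alpha h fstar ->
        (forall g, maximizers W alpha h g ->
           \forall u \ae (@lebesgue_measure R),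
             u \in `[0, 1] -> g u = fstar u) ->
        forall eps : R, 0 < eps ->
          gibbs (Q n) alpha h
            [set X | eps < nrm (proportions R X - mean fstar)]
            @[n --> \oo] --> (0 : R))).
Proof.
have c0 : (0 < c)%N by exact: ltnW.
have [iW _] := hW.
have argmax alpha := energy_argmax iW alpha (softmax_gt0 h c0) (softmax_sum h c0).
split; last split.
- move=> alpha; split; first exact: rate_good.
  exact: LDP_energy.
- move=> alpha; have [f fc fmax] := argmax alpha; split.
    exact: (log_partition_cvg iW Qcvg c0 fc fmax).
  by exists f => //; rewrite (sup_free_energyE c0 fc fmax).
move=> alpha nrm nnrm; have [f fc fmax] := argmax alpha; split=> [eps e0|fstar fs funiq eps e0].
  exact: (gibbs_concentration iW Qcvg c0 fc fmax).
have := gibbs_concentration iW Qcvg c0 fc fmax nnrm e0.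
have meanE g : maximizers W alpha h g -> mean g = mean fstar.
  move=> gmax; apply/rowP => r; rewrite !mxE; congr fine.
  have [gc _] := gmax; have [fsc _] := fs.
  apply: ae_eq_integral => //.
  - by apply/measurable_EFinP; exact: (color_fun_weight r gc).1.
  - by apply/measurable_EFinP; exact: (color_fun_weight r fsc).1.
  - have fu := funiq g gmax; near=> u => uI.
    by rewrite (_ : g u = fstar u)//; move: uI; near: u.
(* [maximizers] contains every representative of the class of [fstar], but they share one mean, so
   the distance to the set of means is the norm itself. *)
have -> : @mean R c @` maximizers W alpha h = [set mean fstar].
  by apply/seteqP; split=> [_ [g gmax <-]|_ ->]; [exact: meanE|exists fstar].
apply: cvg_trans; apply: near_eq_cvg; apply: nearW => n /=; congr gibbs.
by apply/seteqP; split=> X /=; rewrite /dist image_set1 ereal_inf1 lte_fin.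
Unshelve. all: by end_near.
Qed.
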